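(* Let $\Lambda$ be a Bedford--McMullen carpet with non-uniform vertical fibres, with parameters $n>m\ge2$, $M_0\ge2$, $N_1<\dots<N_{M_0}$, $R_1,\dots,R_{M_0}$ (defined in the context). Let $$\mathcal Q=\{\mathbf q=(q_1,\dots,q_{M_0}): R_1q_1+\dots+R_{M_0}q_{M_0}=1,\ q_k>0 \text{ for all } 1\le k\le M_0\},$$ $$\alpha(\mathbf q)=\max_{1\le k,\ell\le M_0}\left\{\frac{\log(q_k/N_k)}{-\log n}+\Big(1-\frac{\log m}{\log n}\Big)\frac{\log q_\ell}{-\log m}\right\}.$$ Then, with the minimum on the left over all non-degenerate probability vectors $\mathbf p$ (all entries positive), $$\min_{\mathbf p}\dim_{\mathrm M}\nu_{\mathbf p}=\min_{\mathbf q\in\mathcal Q}\alpha(\mathbf q).$$ Moreover, $\min_{\mathbf q\in\mathcal Q}\alpha(\mathbf q)$ is attained at a vector either of the form $\mathbf q_K=(q_{K,1},\dots,q_{K,M_0})$ for some $1\le K\le M_0$, where $$q_{K,k}=\begin{cases}N_K\,(N_K|\mathcal R_K|+\|\mathcal R_K^C\|)^{-1}, & k\le K,\\ N_k\,(N_K|\mathcal R_K|+\|\mathcal R_K^C\|)^{-1}, & k>K,\end{cases}$$ or of the form $\mathbf Q_K=(Q_{K,1},\dots,Q_{K,M_0})$ for some $1\le K\le M_0-1$, where $$Q_{K,k}=\Big(1-\frac{\log m}{\log n}\Big)\frac1{|\mathcal R_K|}\ \text{ for } k\le K,\qquad Q_{K,k}=\frac{\log m}{\log n}\,\frac{N_k}{\|\mathcal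 R_K^C\|}\ \text{ for } k>K .$$ Furthermore, if $\mathbf q^*\in\mathcal Q$ satisfies $\alpha(\mathbf q^* )=\min_{\mathbf q\in\mathcal Q}\alpha(\mathbf q)$, then the vector $\mathbf p^*$ defined by $p_i^*=q_k^*/N_k$ whenever the map indexed by $i$ belongs to a column with $N_k$ rectangles attains $\min_{\mathbf p}\dim_{\mathrm M}\nu_{\mathbf p}$.
   Context: Bedford--McMullen carpet: for integers $n>m\ge2$ and an index set $\mathcal A\subseteq\{0,\dots,m-1\}\times\{0,\dots,n-1\}$, consider the maps $f_{(i,j)}(x,y)=(x/m+i/m,\ y/n+j/n)$, $(i,j)\in\mathcal A$, on $[0,1]^2$. The attractor $\Lambda$ (the unique non-empty compact set equal to the union of its images under these maps) is the carpet. The images of $[0,1]^2$ are called rectangles; the rectangles with the same first index $i$ form a column. Among non-empty columns, let $N_1<N_2<\dots<N_{M_0}$ be the distinct values of the number of maps in a column, and $R_k$ the number of columns with exactly $N_k$ maps. The carpet has uniform vertical fibres if $M_0=1$, and non-uniform vertical fibres otherwise. $N=\sum_kR_kN_k$ is the total number of maps (relabelled $f_1,\dots,f_N$). For $1\le K\le M_0$: $|\mathcal R_K|=R_1+\dots+R_K$ and $\|\mathcal R_K^C\|=R_{K+1}N_{K+1}+\dots+R_{M_0}N_{M_0}$ (equal to $0$ if $K=M_0$). For a probability vector $\mathbf p=(p_1,\dots,p_N)$ with all $p_i>0$, $\nu_{\mathbf p}$ is the unique Borel probability measure with $\nu_{\mathbf p}(\cdot)=\sum_{i=1}^Np_i\nu_{\mathbf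 p}(f_i^{-1}(\cdot))$; it is fully supported on $\Lambda$. Minkowski dimensions of a fully supported finite Borel measure $\nu$ on a compact metric space $X$ (here $X=\Lambda$; $B(x,r)$ open balls): $\overline{\dim}_{\mathrm M}(\nu)$ is the infimum of $s\ge0$ for which there is $c>0$ with $\nu(B(x,r))\ge cr^s$ for all $x\in X$, $0<r<1$; $\underline{\dim}_{\mathrm M}(\nu)$ is the infimum of $s\ge0$ for which there are $c>0$ and positive reals $r_n\to0$ with $\nu(B(x,r_n))\ge cr_n^s$ for all $x\in X$, $n\in\mathbb N$. $\dim_{\mathrm M}\nu$ is the common value when they coincide. *)

(* Defs.v *)
From HB Require Import structures.
From mathcomp Require Import all_boot all_order all_algebra.
From mathcomp Require Import all_classical all_reals all_analysis.

Set Implicit Arguments.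
Unset Strict Implicit.
Unset Printing Implicit Defensive.

Import Order.TTheory GRing.Theory Num.Theory.
Import numFieldNormedType.Exports.

Local Open Scope classical_set_scope.
Local Open Scope ring_scope.

Definition is_minimum (R : realType) (S : set (\bar R)) (v : \bar R) : Prop :=
  S v /\ lbound S v.

(** ** Minkowski dimensions of a measure *)

(* The product norm of [R * R] is the sup norm; the plane carries the
   Euclidean distance here. *)
Definition edist (R : realType) (x y : R * R) : R :=
  Num.sqrt ((x.1 - y.1) ^+ 2 + (x.2 - y.2) ^+ 2).

(* Open ball of the metric subspace [X] of the plane. *)
Definition eball (R : realType) (X : set (R * R)) (x : R * R) (r : R) :
    set (R * R) :=
  X `&` [set y | edist x y < r].

(* The infima are taken in [\bar R], so that the infimum of the empty set
   is [+oo]. *)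
Definition upper_minkowski_dim (R : realType) (X : set (R * R))
    (nu : {finite_measure set (R * R)%type -> \bar R}) : \bar R :=
  ereal_inf [set s%:E | s in [set s : R | 0 <= s /\
    exists2 c : R, 0 < c &
      forall (x : R * R) (r : R), X x -> 0 < r < 1 ->
        ((c * r `^ s)%:E <= nu (eball X x r))%E]].

Definition lower_minkowski_dim (R : realType) (X : set (R * R))
    (nu : {finite_measure set (R * R)%type -> \bar R}) : \bar R :=
  ereal_inf [set s%:E | s in [set s : R | 0 <= s /\
    exists (c : R) (r : nat -> R),
      [/\ 0 < c, forall j, 0 < r j, r @ \oo --> (0 : R) &
        forall (x : R * R) (j : nat), X x ->
          ((c * r j `^ s)%:E <= nu (eball X x (r j)))%E]]].

Definition has_minkowski_dim (R : realType) (X : set (R * R))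
    (nu : {finite_measure set (R * R)%type -> \bar R}) (d : \bar R) : Prop :=
  upper_minkowski_dim X nu = d /\ lower_minkowski_dim X nu = d.

(** ** Bedford-McMullen carpets *)

Definition bm_map (R : realType) (m n : nat) (a : 'I_m * 'I_n) (x : R * R) :
    R * R :=
  (x.1 / m%:R + a.1%:R / m%:R, x.2 / n%:R + a.2%:R / n%:R).

Definition is_carpet (R : realType) (m n : nat) (A : {set 'I_m * 'I_n})
    (L : set (R * R)) : Prop :=
  [/\ L !=set0, compact L & L = \bigcup_(a in [set` A]) (bm_map a @` L)].

Section Columns.
Variables (m n : nat) (A : {set 'I_m * 'I_n}).

Definition col_count (i : 'I_m) : nat := #|[set j : 'I_n | (i, j) \in A]|.

(* The list N_1 < ... < N_{M_0}.  Indices start at 0 in all that follows: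
   [k : 'I_M0] stands for the index k + 1 of the mathematical notation. *)
Definition col_sizes : seq nat :=
  sort leq (undup [seq col_count i | i <- enum 'I_m & (0 < col_count i)%N]).

Definition M0 : nat := size col_sizes.

Definition Nk (k : 'I_M0) : nat := nth 0%N col_sizes k.

Definition Rk (k : 'I_M0) : nat := #|[set i : 'I_m | col_count i == Nk k]|.

(* |R_K| *)
Definition Rcard (K : 'I_M0) : nat := (\sum_(k < M0 | (k <= K)%N) Rk k)%N.

(* ||R_K^C|| *)
Definition Rcompl (K : 'I_M0) : nat :=
  (\sum_(k < M0 | (K < k)%N) Rk k * Nk k)%N.

End Columns.

(** ** Self-affine measures *)

(* Weights are functions on all indices; only their values on [A] matter. *)
Definition nondegenerate_weights (R : realType) (m n : nat) (A : {set 'I_m * 'I_n})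
    (p : 'I_m * 'I_n -> R) : Prop :=
  (forall a, a \in A -> 0 < p a) /\ \sum_(a in A) p a = 1.

(* A Borel measure on the unit square is seen as a Borel measure on the plane
   that is concentrated on the square. *)
Definition is_self_affine (R : realType) (m n : nat) (A : {set 'I_m * 'I_n})
    (p : 'I_m * 'I_n -> R) (nu : probability (R * R)%type R) : Prop :=
  nu (`[0, 1] `*` `[0, 1]) = 1%E /\
  forall B : set (R * R), measurable B ->
    nu B = (\sum_(a in A) (p a)%:E * nu (@bm_map R m n a @^-1` B))%E.

(* The choice operator selects the unique solution nu_p; the Dirac mass is a
   dummy value, used only when there is no self-affine measure. *)
Definition self_affine_measure (R : realType) (m n : nat)
    (A : {set 'I_m * 'I_n}) (p : 'I_m * 'I_n -> R) :
    probability (R * R)%type R :=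
  xget (\d_(0 : R, 0 : R) : probability (R * R)%type R)
    [set nu | is_self_affine A p nu].

(** ** The optimisation problem *)

Section Optimisation.
Variables (R : realType) (m n : nat) (A : {set 'I_m * 'I_n}).

Definition Qset : set ('I_(M0 A) -> R) :=
  [set q | \sum_(k < M0 A) (Rk k)%:R * q k = 1 /\ forall k, 0 < q k].

Definition log_ratio : R := ln m%:R / ln n%:R.

(* [-oo] is the neutral element of [maxe]: the iterated maximum over a
   non-empty family is the maximum of the family. *)
Definition alpha (q : 'I_(M0 A) -> R) : \bar R :=
  \big[maxe/-oo%E]_(k < M0 A) \big[maxe/-oo%E]_(l < M0 A)
    (ln (q k / (Nk k)%:R) / (- ln n%:R)
      + (1 - log_ratio) * (ln (q l) / (- ln m%:R)))%:E.

Definition small_q (K k : 'I_(M0 A)) : R :=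
  (if (k <= K)%N then (Nk K)%:R else (Nk k)%:R)
    / ((Nk K)%:R * (Rcard K)%:R + (Rcompl K)%:R).

Definition big_q (K k : 'I_(M0 A)) : R :=
  if (k <= K)%N then (1 - log_ratio) / (Rcard K)%:R
  else log_ratio * ((Nk k)%:R / (Rcompl K)%:R).

End Optimisation.

Arguments Qset R {m n} A.
Arguments log_ratio R m n : clear implicits.
Arguments small_q R {m n A} K k.
Arguments big_q R {m n A} K k.

(* Main.v *)
Require Import Defs.
From HB Require Import structures.
From mathcomp Require Import all_boot all_order all_algebra.
From mathcomp Require Import all_classical all_reals all_analysis.
From mathcomp Require Import measurable_realfun ring lra zify.

Set Implicit Arguments.
Unset Strict Implicit.
Unset Printing Implicit Defensive.

Import Order.TTheory GRing.Theory Num.Theory.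
Import numFieldNormedType.Exports.

Local Open Scope classical_set_scope.
Local Open Scope ring_scope.

(* Let u be the least weight p_a and v the least column weight of p. A ball of
   radius about m^-(l+d) ~ n^-l contains an approximate square, that is, a product
   of a base-m interval of level l+d and a base-n interval of level l, whose mass is
   a product of l weights and d column weights, hence at least u^l v^d. The choice
   of the word with weights u and v throughout, altered in boundedly many letters so
   that the centre stays away from the boundary of the square, gives a ball of mass
   at most a constant times u^l v^d. Hence
     dim_M nu_p = - log u / log n - (1 - theta) log v / log m,  theta = log m / log n.
   Averaging the column weights of p over the columns of equal size does not
   decrease u or v, which reduces the problem to Q. There v a + u b <= 1 with
   a = |R_K|, b = ||R_K^C|| and N_K u <= v <= N_(K+1) u for some K. By the tangent
   inequality of the concave function theta log u + (1 - theta) log v, its maximum on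
   the line v a + u b = 1 is at (theta / b, (1 - theta) / a), i.e. at Q_K, if this point
   lies in the range of v / u, and otherwise at an end point of the range, i.e. at
   q_K or q_(K+1). *)

(** * Existence of self-affine measures *)

Lemma measurable_affine (R : realType) (b c : R) :
  measurable_fun setT (fun x : R => (x - b) / c).
Proof.
apply: measurable_funM => //.
by apply: measurable_funB => //.
Qed.

(** Lebesgue measure is determined by its values on half-open intervals, and the rescaled image
    measure [mu] has the same values there. *)
Lemma lebesgue_measure_affine (R : realType) (b c : R) (C : set R) :
  0 < c -> measurable C ->
  lebesgue_measure ((fun x => (x - b) / c) @^-1` C) =
    (c%:E * lebesgue_measure C)%E.
Proof.
move=> c0 mC.
have ci0 : 0 <= c^-1 by rewrite invr_ge0 ltW.
pose f (x : R) : measurableTypeR R := (x - b) / c.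
have mf : measurable_fun [set: measurableTypeR R] f by exact: measurable_affine.
pose mu : {measure set (measurableTypeR R) -> \bar R} :=
  mscale (NngNum ci0) (pushforward lebesgue_measure f).
rewrite (@lebesgue_measure_unique R (mu mf) _ C mC) => [|X [[x y] _ <-]].
  by rewrite /mu /mscale /= muleA -EFinM divff ?mul1e // gt_eqF.
rewrite /mu /= /mscale /= /pushforward.
have -> : f @^-1` `]x, y] = `]x * c + b, y * c + b]%classic.
  by apply/seteqP; split => t /=; rewrite !in_itv/= /f;
    rewrite ltr_pdivlMr ?ler_pdivrMr // ltrBrDr lerBlDr.
rewrite !lebesgue_measure_itv/= !lte_fin ltrD2r ltr_pM2r //.
case: ifP => // _; last by rewrite mule0.
rewrite -EFinD -EFinM; congr _%:E; field.
by rewrite gt_eqF.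
Qed.

Lemma measure_bigcup_set d (X : measurableType d) (R : realType)
    (mu : {measure set X -> \bar R}) (T : finType) (A : {set T}) (F : T -> set X) :
  (forall a, a \in A -> measurable (F a)) -> trivIset [set` A] F ->
  mu (\bigcup_(a in [set` A]) F a) = (\sum_(a in A) mu (F a))%E.
Proof.
move=> mF tF; rewrite measure_fin_bigcup //.
transitivity (\sum_(a <- enum A) mu (F a))%E; last by rewrite big_enum.
rewrite [RHS]fsbig_seq ?enum_uniq // (_ : [set` enum A] = [set` A]) //.
by apply/seteqP; split=> a /=; rewrite mem_enum.
Qed.

(* The unit interval is cut into cells of lengths p a; the sequence of cells visited
   by the expanding map is an independent sequence of digits with law p. *)
Section Expansion.
Variables (R : realType) (T : finType) (A : {set T}) (p : T -> R).
Hypotheses (p_gt0 : forall a, a \in A -> 0 < p a) (p_sum : \sum_(a in A) p a = 1).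

Definition cut_pt (k : nat) : R := \sum_(a <- take k (enum A)) p a.

Definition cell_start (a : T) : R := cut_pt (index a (enum A)).

Definition cell (a : T) : set R :=
  `[cell_start a, cell_start a + p a[%classic.

Definition cell_map (a : T) (t : R) : R := (t - cell_start a) / p a.

Lemma cut_pt_le j k : (j <= k)%N -> cut_pt j <= cut_pt k.
Proof.
move=> jk; rewrite /cut_pt -(subnKC jk) takeD big_cat /= lerDl.
rewrite big_seq; apply: sumr_ge0 => a /mem_take /mem_drop.
by rewrite mem_enum => /p_gt0 /ltW.
Qed.

Lemma cut_ptS a : a \in A ->
  cut_pt (index a (enum A)).+1 = cell_start a + p a.
Proof.
move=> aA; rewrite /cell_start /cut_pt (take_nth a) ?index_mem ?mem_enum //.
by rewrite nth_index ?mem_enum // big_rcons /= addrC.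
Qed.

Lemma cell_start_ge0 a : 0 <= cell_start a.
Proof.
by have := cut_pt_le (leq0n (index a (enum A))); rewrite {1}/cut_pt take0 big_nil.
Qed.

Lemma sum_enum : \sum_(a <- enum A) p a = 1.
Proof. by rewrite big_enum. Qed.

Lemma cell_end_le1 a : a \in A -> cell_start a + p a <= 1.
Proof.
move=> aA; rewrite -cut_ptS // -sum_enum -[X in _ <= \sum_(i <- X) _](take_size (enum A)).
by apply: cut_pt_le; rewrite index_mem mem_enum.
Qed.

Lemma cell_cover t : 0 <= t < 1 -> exists2 a, a \in A & cell a t.
Proof.
rewrite -sum_enum => /andP[t0 tp].
(* Describing the cell by a splitting of the enumeration allows induction on the list: passing to
   the tail shifts [t] by the weight of the head. *)
suff [s1 [a [s2 [es /andP[ta tb]]]]] : exists s1 a s2, enum A = s1 ++ a :: s2 /\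
    \sum_(b <- s1) p b <= t < \sum_(b <- s1) p b + p a.
  have aA : a \in A by rewrite -mem_enum es mem_cat mem_head orbT.
  exists a => //; rewrite /cell /= in_itv /= /cell_start /cut_pt.
  have := enum_uniq A; rewrite es cat_uniq /= negb_or => /and3P[_ /andP[as1 _] _].
  by rewrite index_cat (negbTE as1) /= eqxx addn0 take_size_cat ?ta.
move: t0 tp; elim: (enum A) t => [t|a s IH t t0]; first by rewrite big_nil; lra.
rewrite big_cons => tp; have [tpa|pat] := ltP t (p a).
  by exists [::], a, s; rewrite big_nil t0 add0r.
have [||s1 [b [s2 [-> /andP[h1 h2]]]]] := IH (t - p a); [lra|lra|].
by exists (a :: s1), b, s2; rewrite big_cons; split=> //; apply/andP; split; lra.
Qed.

Lemma cell_disjoint a b t : a \in A -> b \in A -> cell a t -> cell b t -> a = b.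
Proof.
move=> aA bA; rewrite /cell /= !in_itv /= => /andP[a1 a2] /andP[b1 b2].
have [ab|ba|/index_inj] := ltngtP (index a (enum A)) (index b (enum A)).
- have := cut_pt_le ab; rewrite cut_ptS // -/(cell_start b) => ?; exfalso; lra.
- have := cut_pt_le ba; rewrite cut_ptS // -/(cell_start a) => ?; exfalso; lra.
- by apply; rewrite // mem_enum.
Qed.

Lemma cell_map_unit a t : a \in A -> cell a t = (0 <= cell_map a t < 1) :> Prop.
Proof.
move=> /p_gt0 pa; rewrite /cell /= in_itv /= /cell_map.
by rewrite ler_pdivlMr // ltr_pdivrMr // mul0r mul1r subr_ge0 ltrBlDl.
Qed.

(** * Base-[b] expansions driven by the cells *)

Section Coding.
Variables (b : nat) (dg : T -> nat).
Hypotheses (b_gt0 : (0 < b)%N) (dg_lt : forall a, a \in A -> (dg a < b)%N).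

(** The base-[b] number whose first [k] digits are the labels [dg] of the cells visited by [t],
    followed by zeros. The sum of indicators selects the cell of [t] in a form whose measurability
    is immediate, and gives 0 outside [0,1[. *)
Fixpoint approx_code (k : nat) (t : R) : R :=
  if k is k'.+1 then
    \sum_(a in A) \1_(cell a) t * ((approx_code k' (cell_map a t) + (dg a)%:R) / b%:R)
  else 0.

Lemma approx_codeE k a t : a \in A -> cell a t ->
  approx_code k.+1 t = (approx_code k (cell_map a t) + (dg a)%:R) / b%:R.
Proof.
move=> aA at_ /=; rewrite (bigD1 a) //= big1 ?addr0 => [|c /andP[cA ca]].
  by rewrite indicE mem_set // mul1r.
rewrite indicE memNset ?mul0r // => ct; move/eqP: ca; apply.
exact: cell_disjoint ct at_.
Qed.

Lemma approx_code_out k t : ~~ (0 <= t < 1) -> approx_code k t = 0.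
Proof.
case: k => //= k t01; apply: big1 => a aA; rewrite indicE memNset ?mul0r //.
rewrite /cell /= in_itv /= => /andP[h1 h2]; move/negP: t01; apply.
by have := cell_start_ge0 a; have := cell_end_le1 aA; lra.
Qed.

Lemma approx_code_ge0 k t : 0 <= approx_code k t.
Proof.
elim: k t => //= k IH t; apply: sumr_ge0 => a _.
by rewrite mulr_ge0 ?divr_ge0 ?addr_ge0.
Qed.

Lemma approx_code_le1 k t : approx_code k t <= 1.
Proof.
elim: k t => [|k IH] t; first by rewrite /= ler01.
have [/cell_cover [a aA at_]|/approx_code_out ->] := boolP (0 <= t < 1); last lra.
rewrite (approx_codeE _ aA at_) ler_pdivrMr ?ltr0n // mul1r.
have := IH (cell_map a t).
have : (dg a).+1%:R <= b%:R :> R by rewrite ler_nat dg_lt.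
by rewrite -natr1; lra.
Qed.

(** A longer truncation replaces zeros by non-negative digits. With the bound by 1, this gives
    convergence. *)
Lemma approx_code_nd t : nondecreasing_seq (approx_code ^~ t).
Proof.
apply/nondecreasing_seqP => k; elim: k t => [|k IH] t; first exact: approx_code_ge0.
have [/cell_cover [a aA at_]|h] := boolP (0 <= t < 1); last by rewrite !approx_code_out.
rewrite (approx_codeE k.+1 aA at_) (approx_codeE k aA at_).
by rewrite ler_pM2r ?invr_gt0 ?ltr0n // lerD2r.
Qed.

Definition code (t : R) : R := limn (approx_code ^~ t).

Lemma approx_code_cvg t : approx_code ^~ t @ \oo --> code t.
Proof.
apply: nondecreasing_is_cvgn; first exact: approx_code_nd.
by exists 1 => _ [k _ <-]; exact: approx_code_le1.
Qed.

Lemma code_ge0 t : 0 <= code t.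
Proof.
apply: limr_ge; first exact: approx_code_cvg.
by near=> k; exact: approx_code_ge0.
Unshelve. all: by end_near. Qed.

Lemma code_le1 t : code t <= 1.
Proof.
apply: limr_le; first exact: approx_code_cvg.
by near=> k; exact: approx_code_le1.
Unshelve. all: by end_near. Qed.

(** The limit of the recursion: the expanding map on the cell of [a] removes the first digit. This
    is the source of self-affinity. *)
Lemma codeE a t : a \in A -> cell a t ->
  code t = (code (cell_map a t) + (dg a)%:R) / b%:R.
Proof.
move=> aA at_.
have h1 : (fun k => approx_code k.+1 t) @ \oo --> code t.
  by rewrite (cvg_shiftS (approx_code ^~ t)); exact: approx_code_cvg.
have h2 : (fun k => approx_code k.+1 t) @ \oo -->
    (code (cell_map a t) + (dg a)%:R) / b%:R.
  under eq_fun do rewrite (approx_codeE _ aA at_).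
  by apply: cvgMr_tmp; apply: cvgD; [exact: approx_code_cvg|exact: cvg_cst].
by rewrite -(cvg_lim (@Rhausdorff R) h1) (cvg_lim (@Rhausdorff R) h2).
Qed.

Lemma measurable_cell a : measurable (cell a).
Proof. exact: measurable_itv. Qed.

Lemma measurable_approx_code k : measurable_fun setT (approx_code k).
Proof.
elim: k => [|k IH] /=; first exact: measurable_cst.
rewrite (_ : (fun t => _) = fun t => \sum_(a <- enum A) \1_(cell a) t *
    ((approx_code k (cell_map a t) + (dg a)%:R) / b%:R)); last first.
  by apply/funext => t; rewrite big_enum.
apply: measurable_sum => a.
apply: measurable_funM.
  exact: measurable_indic (measurable_cell a).
apply: measurable_funM => //; apply: measurable_funD => //.
apply: (measurableT_comp IH).
exact: measurable_affine.
Qed.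

Lemma measurable_code : measurable_fun setT code.
Proof.
apply: (measurable_fun_cvg measurable_approx_code) => t _.
exact: approx_code_cvg.
Qed.

End Coding.

End Expansion.

Lemma measurable_bm_map (R : realType) (m n : nat) (a : 'I_m * 'I_n) :
  measurable_fun setT (@bm_map R m n a).
Proof.
by apply: measurable_fun_pair; apply: measurable_funD => //;
  apply: measurable_funM.
Qed.

Lemma pushforward_probability d d' (X : measurableType d) (Y : measurableType d')
    (R : realType) (mu : {measure set X -> \bar R}) (f : X -> Y) :
  measurable_fun setT f -> mu setT = 1%E ->
  exists nu : probability Y R, forall B, nu B = mu (f @^-1` B).
Proof.
move=> mf muT.
pose nu : {measure set Y -> \bar R} := pushforward mu f.
have nuT : nu mf setT = 1%E by [].
(* Normalisation by the total mass 1 changes no value; it supplies the bundled [probability]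
   structure. *)
exists (mnormalize (nu mf) (\d_point : probability Y R)) => B.
by rewrite /= /mnormalize nuT onee_eq0 /= invr1 mule1.
Qed.

(** The measure is the image of Lebesgue measure on [0,1[ under [f], whose coordinates expand the
    same sequence of letters in bases [m] and [n]. On the cell of [a], [f] is [bm_map a] applied to
    [f] at the image under the cell map, which stretches lengths by 1 / [p a]; the sum over the
    cells gives the self-affine identity. *)
Lemma self_affine_exists (R : realType) (m n : nat) (A : {set 'I_m * 'I_n})
    (p : 'I_m * 'I_n -> R) :
  nondegenerate_weights A p ->
  exists nu : probability (R * R)%type R, is_self_affine A p nu.
Proof.
move=> [p_gt0 p_sum].
have [a0 a0A] : exists a, a \in A.
  apply/existsP; apply: contraT; rewrite negb_exists => /forallP h.
  by move: p_sum; rewrite big1 => [/esym/eqP|a]; rewrite ?oner_eq0 // (negbTE (h a)).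
have m_gt0 : (0 < m)%N by case: a0 {a0A} => i _; exact: leq_ltn_trans (ltn_ord i).
have n_gt0 : (0 < n)%N by case: a0 {a0A} => _ i; exact: leq_ltn_trans (ltn_ord i).
pose c1 := code A p m (fun a => a.1); pose c2 := code A p n (fun a => a.2).
have dg1 (a : 'I_m * 'I_n) : a \in A -> (a.1 < m)%N by [].
have dg2 (a : 'I_m * 'I_n) : a \in A -> (a.2 < n)%N by [].
pose f (t : measurableTypeR R) : R * R := (c1 t, c2 t).
have mf : measurable_fun setT f.
  by apply: measurable_fun_pair; exact: measurable_code.
have mI : measurable (`[0, 1[%classic : set (measurableTypeR R)) by exact: measurable_itv.
pose mu : {measure set (measurableTypeR R) -> \bar R} := mrestr lebesgue_measure mI.
have muT : mu setT = 1%E.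
  rewrite /mu /= /mrestr setTI lebesgue_measure_itv /=.
  by rewrite lte_fin ltr01 sube0.
have [nu nuE] := pushforward_probability mf muT.
exists nu; split.
  rewrite nuE -[RHS]muT; congr (mu _); apply/seteqP; split=> // t _ /=.
  by rewrite !in_itv /= !code_ge0 ?code_le1.
move=> B mB.
have mfB C : measurable C -> measurable (f @^-1` C).
  by move=> mC; rewrite -[X in measurable X]setTI; exact: mf.
have mg a : measurable (@bm_map R m n a @^-1` B).
  by rewrite -[X in measurable X]setTI; exact: measurable_bm_map.
have fE a t : a \in A -> cell A p a t -> f t = bm_map a (f (cell_map A p a t)).
  move=> aA at_; rewrite /f /bm_map /= /c1 /c2.
  by rewrite (codeE p_gt0 p_sum m_gt0 dg1 aA at_) (codeE p_gt0 p_sum n_gt0 dg2 aA at_) !mulrDl.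
have cE a : a \in A -> f @^-1` B `&` cell A p a =
    cell_map A p a @^-1` (f @^-1` (@bm_map R m n a @^-1` B) `&` `[0, 1[%classic).
  move=> aA; apply/seteqP; split=> t [] /=.
    by move=> h h2; rewrite in_itv /= -(cell_map_unit p_gt0 t aA) -(fE _ _ aA).
  by rewrite in_itv /= -(cell_map_unit p_gt0 t aA) => h h2; rewrite (fE _ _ aA).
rewrite nuE; under eq_bigr do rewrite nuE.
rewrite /mu /= /mrestr.
transitivity (lebesgue_measure (\bigcup_(a in [set` A]) (f @^-1` B `&` cell A p a))).
  congr lebesgue_measure; rewrite -setI_bigcupr; congr (_ `&` _).
  apply/seteqP; split=> t /=; rewrite in_itv /=.
    by move=> /(cell_cover p_sum)[a aA at_]; exists a.
  move=> [a /= aA]; rewrite /cell /= in_itv /= => /andP[h1 h2].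
  by have := cell_start_ge0 p_gt0 a; have := cell_end_le1 p_gt0 p_sum aA; lra.
rewrite measure_bigcup_set.
- apply: eq_bigr => a aA; rewrite cE //.
  apply: lebesgue_measure_affine; first exact: p_gt0.
  by apply: measurableI => //; exact: mfB.
- by move=> a _; apply: measurableI; [exact: mfB|exact: measurable_cell].
- move=> a b /= aA bA [t [[_ h1] [_ h2]]].
  exact: (cell_disjoint p_gt0 aA bA h1 h2).
Qed.

(** * The carpet and its mass *)

Lemma expr_inv_lt (R : realType) (b M e : R) : 1 < b -> 0 < e ->
  exists k : nat, M / b ^+ k < e.
Proof.
move=> b1 e0; have b0 : 0 < b by lra.
have bi : `|b^-1| < 1 by rewrite ger0_norm ?invr_ge0 ?invf_lt1 // ltW.
have := @cvg_geometric R M b^-1 bi.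
move/cvgrPdist_lt/(_ _ e0) => [k _ /(_ k (leqnn k))] /=.
rewrite /geometric /= sub0r normrN exprVn => h; exists k.
exact: le_lt_trans (ler_norm _) h.
Qed.

Lemma le_expr_inv (R : realType) (b M x y : R) : 1 < b ->
  (forall k, x <= y + M / b ^+ k) -> x <= y.
Proof.
move=> b1 h; apply/ler_addgt0Pr => e e0.
have [k hk] := expr_inv_lt M b1 e0.
by have := h k; lra.
Qed.

Section Carpet.
Variables (R : realType) (m n : nat) (A : {set 'I_m * 'I_n}) (L : set (R * R)).
Hypotheses (m_gt1 : (1 < m)%N) (mn : (m < n)%N) (hL : is_carpet A L).

Let m_gt0 : 0 < m%:R :> R. Proof. by rewrite ltr0n; lia. Qed.
Let n_gt0 : 0 < n%:R :> R. Proof. by rewrite ltr0n; lia. Qed.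
Let m_gt1R : 1 < m%:R :> R. Proof. by rewrite ltr1n. Qed.
Let n_gt1R : 1 < n%:R :> R. Proof. by rewrite ltr1n; lia. Qed.
Let m_neq0 : m%:R != 0 :> R. Proof. by rewrite gt_eqF. Qed.
Let n_neq0 : n%:R != 0 :> R. Proof. by rewrite gt_eqF. Qed.

Definition unit_square : set (R * R) := `[0, 1] `*` `[0, 1].

Definition bm_inv (a : 'I_m * 'I_n) (z : R * R) : R * R :=
  (z.1 * m%:R - a.1%:R, z.2 * n%:R - a.2%:R).

Lemma bm_mapK a z : bm_inv a (bm_map a z) = z.
Proof. by case: z => x y; congr pair; rewrite /=; field. Qed.

Lemma bm_invK a z : bm_map a (bm_inv a z) = z.
Proof. by case: z => x y; congr pair; rewrite /=; field. Qed.

Lemma measurable_bm_inv a : measurable_fun setT (bm_inv a).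
Proof.
by apply: measurable_fun_pair; apply: measurable_funB => //;
  apply: measurable_funM.
Qed.

Lemma digit1_le (a : 'I_m * 'I_n) : a.1%:R + 1 <= m%:R :> R.
Proof. by rewrite natr1 ler_nat. Qed.

Lemma digit2_le (a : 'I_m * 'I_n) : a.2%:R + 1 <= n%:R :> R.
Proof. by rewrite natr1 ler_nat. Qed.

Lemma carpet_map a z : a \in A -> L z -> L (bm_map a z).
Proof. by move=> aA Lz; case: hL => _ _ ->; exists a => //; exists z. Qed.

Lemma carpet_inv z : L z -> exists2 a, a \in A & exists2 y, L y & z = bm_map a y.
Proof.
by case: hL => _ _ {1}-> [a /= aA [y Ly <-]]; exists a => //; exists y.
Qed.

(** Compactness gives some bound [C]. The maps preserve the square and contract, so each of them
    divides the overshoot out of the square by [m] or [n]; as [L] reproduces itself, the overshoot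
    vanishes in the limit. *)
Lemma carpet_sub_square : L `<=` unit_square.
Proof.
have [_ cL _] := hL.
have [M [_ /(_ (M + 1)) hM]] := compact_bounded cL.
have {}hM z : L z -> `|z.1| <= M + 1 /\ `|z.2| <= M + 1.
  move=> Lz; have := hM _ z Lz; rewrite ltrDl ltr01 => /(_ isT).
  move=> h; have {h} : Num.max `|z.1| `|z.2| <= M + 1 := h.
  by rewrite ge_max => /andP.
set C := M + 1 in hM.
have h k z : L z -> [/\ z.1 <= 1 + C / m%:R ^+ k, - z.1 <= 0 + C / m%:R ^+ k,
    z.2 <= 1 + C / n%:R ^+ k & - z.2 <= 0 + C / n%:R ^+ k].
  elim: k z => [|k IH] z Lz.
    by have [] := hM _ Lz; rewrite !ler_norml !expr0 !divr1 => /andP[? ?] /andP[? ?]; split; lra.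
  have [a aA [y Ly ->]] := carpet_inv Lz.
  have [h1 h2 h3 h4] := IH _ Ly.
  have d1 := digit1_le a; have d2 := digit2_le a.
  have e1 : 0 <= a.1%:R :> R by []. have e2 : 0 <= a.2%:R :> R by [].
  have eC b : C / b ^+ k.+1 = C / b ^+ k / b by rewrite exprSr invfM mulrA.
  have up (b d t c : R) : 0 < b -> d + 1 <= b -> t <= 1 + c -> t / b + d / b <= 1 + c / b.
    by move=> b0 ? ?; rewrite -mulrDl ler_pdivrMr // mulrDl divfK ?gt_eqF //; lra.
  have lo (b d t c : R) : 0 < b -> 0 <= d -> - t <= 0 + c -> - (t / b + d / b) <= 0 + c / b.
    by move=> b0 ? ?; rewrite -mulrDl -mulNr add0r ler_pM2r ?invr_gt0 //; lra.
  by rewrite !eC; split; [exact: up|exact: lo|exact: up|exact: lo].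
move=> z Lz; split=> /=; rewrite in_itv /=; apply/andP; split.
- by rewrite -oppr_le0; apply: (@le_expr_inv _ m%:R C) => // k; have [] := h k _ Lz.
- by apply: (@le_expr_inv _ m%:R C) => // k; have [] := h k _ Lz.
- by rewrite -oppr_le0; apply: (@le_expr_inv _ n%:R C) => // k; have [] := h k _ Lz.
- by apply: (@le_expr_inv _ n%:R C) => // k; have [] := h k _ Lz.
Qed.

(* Written with inverse branches, so that measurability is that of a preimage. *)
Fixpoint level (k : nat) : set (R * R) :=
  if k is k'.+1 then \bigcup_(a in [set` A]) (bm_inv a @^-1` level k')
  else unit_square.

Lemma measurable_level k : measurable (level k).
Proof.
elim: k => [|k IH] /=; first exact: measurableX.
apply: fin_bigcup_measurable => // a _.
by rewrite -[X in measurable X]setTI; exact: measurable_bm_inv.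
Qed.

(** A piece of level [k] is the image of the unit square under a word of length [k]. Its sides are
    at most m^-k, and it contains the image of a point of [L] under the same word. *)
Lemma level_near k z : level k z -> exists2 y, L y &
  `|z.1 - y.1| <= 1 / m%:R ^+ k /\ `|z.2 - y.2| <= 1 / m%:R ^+ k.
Proof.
elim: k z => [|k IH] z /=.
  move=> [/=]; rewrite !in_itv /= => h1 h2; have [[y Ly] _ _] := hL; exists y => //.
  have [/=] := carpet_sub_square Ly; rewrite !in_itv /= !expr0 divr1 !ler_norml; lra.
move=> [a /= aA /IH[y Ly [h1 h2]]]; exists (bm_map a y); first exact: carpet_map.
rewrite -[z](bm_invK a); move: (bm_inv a z) h1 h2 => {}z h1 h2.
have dE (t d s b : R) : t / b + d / b - (s / b + d / b) = (t - s) / b by ring.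
rewrite /bm_map /= !dE !normrM !normfV !normr_nat.
rewrite !exprSr !invfM !mulrA; split; first by rewrite ler_pM2r ?invr_gt0.
by apply: ler_pM => //; rewrite lef_pV2 // ?ler_nat ?posrE // ltnW.
Qed.

(** A point of all levels is a limit of points of [L], which is closed. This description makes [L]
    measurable and shows that it has full mass. *)
Lemma carpetE : L = \bigcap_k level k.
Proof.
apply/seteqP; split=> z.
  move=> Lz k _; elim: k z Lz => [|k IH] z Lz; first exact: carpet_sub_square.
  by have [a aA [y Ly ->]] := carpet_inv Lz; exists a => //=; rewrite bm_mapK; exact: IH.
move=> Ez; have [_ cL _] := hL.
have : closed L by apply: compact_closed => //; exact: norm_hausdorff.
apply=> B /nbhs_ballP[e /= e0 eB].
have [k hk] := expr_inv_lt 1 m_gt1R e0.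
have [y Ly [h1 h2]] := level_near (Ez k I).
exists y; split => //; apply: eB; split => /=; exact: le_lt_trans hk.
Qed.

Lemma measurable_carpet : measurable L.
Proof. by rewrite carpetE; apply: bigcapT_measurable; exact: measurable_level. Qed.

(** * Mass of the carpet under a self-affine measure *)

Section Measure.
Variables (p : 'I_m * 'I_n -> R) (nu : probability (R * R)%type R).
Hypotheses (hp : nondegenerate_weights A p) (hnu : is_self_affine A p nu).

Definition prob (B : set (R * R)) : R := fine (nu B).

Lemma probE B : measurable B -> nu B = (prob B)%:E.
Proof. by move=> mB; rewrite fineK // fin_num_measure. Qed.

Lemma prob_le B C : measurable B -> measurable C -> B `<=` C -> prob B <= prob C.
Proof.
by move=> mB mC BC; rewrite -lee_fin -!probE //; apply: le_measure; rewrite ?inE.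
Qed.

Lemma prob_ge0 B : 0 <= prob B.
Proof. exact/fine_ge0/measure_ge0. Qed.

Lemma prob_le1 B : measurable B -> prob B <= 1.
Proof. by move=> mB; rewrite -lee_fin -probE //; exact: probability_le1. Qed.

Lemma measurable_square : measurable unit_square.
Proof. exact: measurableX. Qed.

Lemma prob_square : prob unit_square = 1.
Proof. by rewrite /prob /unit_square hnu.1. Qed.

Lemma measurable_preimage_bm a B : measurable B -> measurable (@bm_map R m n a @^-1` B).
Proof. by move=> mB; rewrite -[X in measurable X]setTI; exact: measurable_bm_map. Qed.

Lemma prob_self_affine B : measurable B ->
  prob B = \sum_(a in A) p a * prob (@bm_map R m n a @^-1` B).
Proof.
move=> mB; apply: EFin_inj; rewrite -probE // hnu.2 // -sumEFin.
by apply: eq_bigr => a aA; rewrite probE //; exact: measurable_preimage_bm.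
Qed.

Lemma prob_full B D : measurable B -> measurable D -> prob D = 1 ->
  prob (B `&` D) = prob B.
Proof.
move=> mB mD D1; have mBD := measurableI _ _ mB mD.
have mBD' := measurableD mB mD.
have BD0 : prob (B `\` D) = 0.
  have DC0 : prob (~` D) = 0 by rewrite /prob probability_setC // probE // D1 -EFinB subrr.
  apply/eqP; rewrite eq_le prob_ge0 andbT -DC0.
  by apply: prob_le => //; exact: measurableC.
apply: EFin_inj; rewrite -!probE // -[in RHS](setUIDK B D) measureU //.
  by rewrite [X in (_ + X)%E]probE // BD0 adde0.
by apply/seteqP; split=> // z [[_ ?] [_]].
Qed.

(** Each [bm_map a] sends level [k] into level [k.+1], so self-affinity bounds the mass of level
    [k.+1] below by a weighted average of ones. *)
Lemma prob_level k : prob (level k) = 1.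
Proof.
elim: k => [|k IH]; first exact: prob_square.
have mE := measurable_level k.+1.
apply/eqP; rewrite eq_le (prob_le1 mE) andTb (prob_self_affine mE).
rewrite -[X in X <= _]hp.2 ler_sum // => a aA.
rewrite ler_peMr ?(ltW (hp.1 _ aA)) // -IH.
apply: prob_le; [exact: measurable_level|exact: measurable_preimage_bm|].
by move=> z Ez; exists a => //=; rewrite bm_mapK.
Qed.

Lemma prob_carpet : prob L = 1.
Proof.
have h : nu (~` L) = 0.
  apply: measure_negligible; first by apply: measurableC; exact: measurable_carpet.
  rewrite carpetE setC_bigcap; apply: negligible_bigcup => k.
  apply/negligibleP; first by apply: measurableC; exact: measurable_level.
  rewrite /= probability_setC; last exact: measurable_level.
  by rewrite probE ?prob_level -?EFinB ?subrr //; exact: measurable_level.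
have := probability_setC nu measurable_carpet.
rewrite h (probE measurable_carpet) -EFinB => -[] /eqP.
by rewrite eq_sym subr_eq0 => /eqP.
Qed.

(** * Masses of approximate squares *)

Definition column_weight (i : 'I_m) : R := \sum_(a in A | a.1 == i) p a.

Lemma column_weight_ge0 i : 0 <= column_weight i.
Proof. by apply: sumr_ge0 => a /andP[aA _]; exact/ltW/hp.1. Qed.

Lemma column_weight_le1 i : column_weight i <= 1.
Proof.
rewrite -[X in _ <= X]hp.2 /column_weight big_mkcondr /=.
by apply: ler_sum => a aA; case: ifP => // _; exact/ltW/hp.1.
Qed.

(** Strips are unbounded vertically: their masses are those of the projection of [nu] to the first
    axis, which is self-similar with the column weights. *)
Definition closed_strip (c s : R) : set (R * R) := [set u | `|u - c| <= s] `*` setT.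
Definition open_strip (c s : R) : set (R * R) := [set u | `|u - c| < s] `*` setT.
Definition closed_box (z : R * R) (s t : R) : set (R * R) :=
  [set u | `|u - z.1| <= s] `*` [set v | `|v - z.2| <= t].
Definition open_box (z : R * R) (s t : R) : set (R * R) :=
  [set u | `|u - z.1| < s] `*` [set v | `|v - z.2| < t].

Lemma measurable_le_dist (c s : R) : measurable [set u : R | `|u - c| <= s].
Proof.
rewrite (_ : [set _ | _] = `[c - s, c + s]%classic); first exact: measurable_itv.
by apply/seteqP; split=> u /=; rewrite in_itv /= ler_distl.
Qed.

Lemma measurable_lt_dist (c s : R) : measurable [set u : R | `|u - c| < s].
Proof.
rewrite (_ : [set _ | _] = `]c - s, c + s[%classic); first exact: measurable_itv.
by apply/seteqP; split=> u /=; rewrite in_itv /= ltr_distl.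
Qed.

Lemma measurable_closed_strip c s : measurable (closed_strip c s).
Proof. by apply: measurableX => //; exact: measurable_le_dist. Qed.

Lemma measurable_open_strip c s : measurable (open_strip c s).
Proof. by apply: measurableX => //; exact: measurable_lt_dist. Qed.

Lemma measurable_closed_box z s t : measurable (closed_box z s t).
Proof. by apply: measurableX; exact: measurable_le_dist. Qed.

Lemma measurable_open_box z s t : measurable (open_box z s t).
Proof. by apply: measurableX; exact: measurable_lt_dist. Qed.

Lemma affine_dist (b x y d e : R) : 0 < b ->
  `|x / b + d / b - (y / b + e / b)| = `|x + d - (y + e)| / b.
Proof.
move=> b0; rewrite -[in RHS](ger0_norm (ltW b0)) -normfV -normrM; congr `|_|.
by ring.
Qed.

Lemma affine_dist_same (b x y d : R) : 0 < b ->
  `|x / b + d / b - (y / b + d / b)| = `|x - y| / b.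
Proof. by move=> b0; rewrite affine_dist //; congr (`|_| / _); ring. Qed.

Lemma prob_bm_ge a B : a \in A -> measurable B ->
  p a * prob (@bm_map R m n a @^-1` B) <= prob B.
Proof.
move=> aA mB; rewrite (prob_self_affine mB) (bigD1 a) //= lerDl.
apply: sumr_ge0 => b /andP[bA _].
by rewrite mulr_ge0 ?prob_ge0 // ltW // hp.1.
Qed.

Lemma prob_disjoint B : measurable B -> B `&` unit_square = set0 -> prob B = 0.
Proof.
move=> mB B0; rewrite -(prob_full mB measurable_square prob_square) B0.
by rewrite /prob measure0.
Qed.

(** * Lower bound for the mass of approximate squares *)

Section LowerBound.
Variables pmin qmin : R.
Hypotheses (pmin_ge0 : 0 <= pmin) (pmin_le : forall a, a \in A -> pmin <= p a).
Hypotheses (qmin_ge0 : 0 <= qmin)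
  (qmin_le : forall a, a \in A -> qmin <= column_weight a.1).

(** All maps in the column of the first letter of [z] pull the strip back to the same wider strip,
    so each level costs a whole column weight. At width 1 the strip covers the square. *)
Lemma prob_strip_ge d z : L z -> qmin ^+ d <= prob (closed_strip z.1 (m%:R ^- d)).
Proof.
elim: d z => [|d IH] z Lz.
  rewrite !expr0 invr1 -[X in X <= _]prob_square; apply: prob_le; [exact: measurable_square|exact: measurable_closed_strip|].
  move=> u /= [/= h _]; split=> //=; have [/= h2 _] := carpet_sub_square Lz.
  by move: h h2; rewrite !in_itv /= ler_norml => ? ?; lra.
have [a aA [y Ly ->]] := carpet_inv Lz.
rewrite exprS (prob_self_affine (measurable_closed_strip _ _)).
apply: (@le_trans _ _ (column_weight a.1 * prob (closed_strip y.1 (m%:R ^- d)))).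
  by apply: ler_pM; rewrite ?exprn_ge0 ?qmin_le ?IH.
rewrite /column_weight mulr_suml big_mkcondr /=; apply: ler_sum => b bA.
case: ifP => [/eqP ba|_]; last by rewrite mulr_ge0 ?prob_ge0 // ltW // hp.1.
rewrite (_ : _ @^-1` _ = closed_strip y.1 (m%:R ^- d)) //.
apply/seteqP; split=> u /= [h _]; split => //; move: h;
  by rewrite /= ba affine_dist_same // exprSr invfM ler_pM2r ?invr_gt0.
Qed.

(** For the first [l] levels only the map of the first letter is kept, at the cost of one weight
    each. After that the box is tall enough to act as a strip on the square, and the other [d]
    levels cost column weights. *)
Lemma prob_box_ge l d z : L z ->
  pmin ^+ l * qmin ^+ d <= prob (closed_box z (m%:R ^- (l + d)) (n%:R ^- l)).
Proof.
elim: l z => [|l IH] z Lz.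
  rewrite !expr0 mul1r add0n invr1; apply: (le_trans (prob_strip_ge d Lz)).
  rewrite -(prob_full (measurable_closed_strip _ _) measurable_square prob_square).
  apply: prob_le; [|exact: measurable_closed_box|].
    by apply: measurableI; [exact: measurable_closed_strip|exact: measurable_square].
  move=> u /= [[/= h _] [/= _ h2]]; split=> //=; have [/= _ h3] := carpet_sub_square Lz.
  by move: h2 h3; rewrite !in_itv /= ler_norml => ? ?; lra.
have [a aA [y Ly ->]] := carpet_inv Lz.
rewrite exprS -mulrA; apply: (le_trans _ (prob_bm_ge aA (measurable_closed_box _ _ _))).
apply: ler_pM; rewrite ?mulr_ge0 ?exprn_ge0 ?pmin_le //.
rewrite (_ : _ @^-1` _ = closed_box y (m%:R ^- (l + d)) (n%:R ^- l)); first exact: IH.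
apply/seteqP; split=> u /= [h h2]; split => //; move: h h2;
  by rewrite /= !affine_dist_same // !exprSr !invfM !ler_pM2r ?invr_gt0.
Qed.

End LowerBound.

Lemma digit_dist (i j : nat) : i != j -> 1 <= `|i%:R - j%:R| :> R.
Proof.
rewrite neq_ltn => /orP[ij|ij].
  by rewrite distrC ler_normr; apply/orP; left; rewrite lerBrDl natr1 ler_nat.
by rewrite ler_normr; apply/orP; left; rewrite lerBrDl natr1 ler_nat.
Qed.

(* An open interval inside (0,1) cannot meet an integer translate of [0,1]. *)
Lemma other_digit_out (i j : nat) (x y s : R) : i != j -> s <= y <= 1 - s ->
  0 <= x <= 1 -> s <= `|x + i%:R - (y + j%:R)|.
Proof.
move=> /digit_dist; rewrite !ler_normr.
by move=> /orP[h|h] /andP[? ?] /andP[? ?]; apply/orP; [left|right]; lra.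
Qed.

(** The condition on [c] keeps the image strip inside the column of [a]: the maps of other columns
    pull it back outside the square. Hence an equality. *)
Lemma prob_strip_bm (a : 'I_m * 'I_n) (c s : R) : s <= c <= 1 - s ->
  prob (open_strip (c / m%:R + a.1%:R / m%:R) (s / m%:R)) =
    column_weight a.1 * prob (open_strip c s).
Proof.
move=> hc; rewrite (prob_self_affine (measurable_open_strip _ _)).
rewrite /column_weight mulr_suml big_mkcondr /=; apply: eq_bigr => b bA.
case: ifPn => [/eqP ba|ba].
  rewrite (_ : _ @^-1` _ = open_strip c s) //.
  apply/seteqP; split=> u /= [h _]; split => //; move: h;
    by rewrite /= ba affine_dist_same // ltr_pM2r ?invr_gt0.
rewrite prob_disjoint ?mulr0 //.
  by apply: measurable_preimage_bm; exact: measurable_open_strip.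
apply/seteqP; split=> // u [[/= h _] [/= hu _]]; move: h hu.
rewrite in_itv /= affine_dist // ltr_pM2r ?invr_gt0 // => h hu.
by have := other_digit_out ba hc hu; lra.
Qed.

(** A map other than that of [a] differs in one of its two digits, and in either case it pulls the
    box back outside the square. *)
Lemma prob_box_bm (a : 'I_m * 'I_n) (z : R * R) (s t : R) : a \in A -> s <= z.1 <= 1 - s -> t <= z.2 <= 1 - t ->
  prob (open_box (bm_map a z) (s / m%:R) (t / n%:R)) = p a * prob (open_box z s t).
Proof.
move=> aA hs ht; rewrite (prob_self_affine (measurable_open_box _ _ _)).
rewrite (bigD1 a) //= big1 ?addr0 => [|b /andP[bA ba]].
  rewrite (_ : _ @^-1` _ = open_box z s t) //.
  apply/seteqP; split=> u /= [h h2]; split => //; move: h h2;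
    by rewrite /= !affine_dist_same // !ltr_pM2r ?invr_gt0.
rewrite prob_disjoint ?mulr0 //.
  by apply: measurable_preimage_bm; exact: measurable_open_box.
apply/seteqP; split=> // u [[/= h1 h2] [/= hu1 hu2]]; move: h1 h2 hu1 hu2.
rewrite !in_itv /= !affine_dist // !ltr_pM2r ?invr_gt0 // => h1 h2 hu1 hu2.
have [e1|ne1] := eqVneq (b.1 : nat) a.1; last by have := other_digit_out ne1 hs hu1; lra.
have [e2|ne2] := eqVneq (b.2 : nat) a.2; last by have := other_digit_out ne2 ht hu2; lra.
by move/eqP: ba; apply; rewrite [a]surjective_pairing [b]surjective_pairing (val_inj e1) (val_inj e2).
Qed.

(** Carries the position condition of [prob_strip_bm] and [prob_box_bm] from one level to the
    next. *)
Lemma affine_inside (b : R) (d : nat) (c s : R) : 1 < b -> d%:R + 1 <= b -> 0 <= s ->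
  s <= c <= 1 - s -> s / b <= c / b + d%:R / b <= 1 - s / b.
Proof.
move=> b1 db s0 /andP[h1 h2]; have b0 : 0 < b by lra.
have d0 : 0 <= d%:R :> R by [].
rewrite -mulrDl ler_pM2r ?invr_gt0 //; apply/andP; split; first lra.
by rewrite ler_pdivrMr // mulrBl divfK ?gt_eqF //; lra.
Qed.

(* Supplies the letters that keep the centre of a small ball off the boundary. *)
Lemma two_digits_inside (b : R) (i j : nat) (x : R) : 1 < b -> j%:R + 1 <= b ->
  (i < j)%N -> 0 <= x <= 1 ->
  b ^- 2 <= (x / b + j%:R / b) / b + i%:R / b <= 1 - b ^- 2.
Proof.
move=> b1 jb ij /andP[x0 x1]; have b0 : 0 < b by lra.
have ij' : i%:R + 1 <= j%:R :> R by rewrite natr1 ler_nat.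
have i0 : 0 <= i%:R :> R by [].
set e := b^-1; have e0 : 0 < e by rewrite invr_gt0.
have eb : e * b = 1 by rewrite mulVf // gt_eqF.
have e1 : e <= 1 by rewrite invf_le1 // ltW.
rewrite -exprVn -/e; apply/andP; split.
  have : 0 <= e ^+ 2 * (x + j%:R - 1) by rewrite mulr_ge0 ?sqr_ge0 //; lra.
  have : 0 <= i%:R * e by rewrite mulr_ge0 // ltW.
  nra.
have h1 : 0 <= e * (1 - x) by rewrite mulr_ge0 ?subr_ge0 // ltW.
have h2 : e * (j%:R + 1) <= 1 by rewrite -[X in _ <= X]eb ler_pM2l.
have h3 : e * (i%:R + 2) <= 1 by rewrite -[X in _ <= X]eb ler_pM2l //; lra.
nra.
Qed.

(** * Approximate squares of small mass *)

Section UpperBound.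
Variables (a0 a1 b1 b2 c1 c2 : 'I_m * 'I_n).
Hypotheses (a0A : a0 \in A) (a1A : a1 \in A) (b1A : b1 \in A) (b2A : b2 \in A)
  (c1A : c1 \in A) (c2A : c2 \in A).
Hypotheses (b12 : (b1.1 < b2.1)%N) (c12 : (c1.2 < c2.2)%N).

Let delta : R := n%:R ^- 2.

Let delta_ge0 : 0 <= delta.
Proof. by rewrite invr_ge0 exprn_ge0 // ltW. Qed.

(** The letters [b1], [b2] give a point at distance at least m^-2 from the vertical sides. Then [a1]
    is prepended [d] times, and each copy multiplies the mass by exactly its column weight. *)
Lemma prob_strip_small d : exists2 z, L z &
  delta / m%:R ^+ d <= z.1 <= 1 - delta / m%:R ^+ d /\
  prob (open_strip z.1 (delta / m%:R ^+ d)) <= column_weight a1.1 ^+ d.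
Proof.
elim: d => [|d [z Lz [hz IH]]].
  have [[y Ly] _ _] := hL; have [/= hy _] := carpet_sub_square Ly.
  exists (bm_map b1 (bm_map b2 y)); first by do 2! apply: carpet_map => //.
  rewrite !expr0 divr1; split; last first.
    by apply: prob_le1; exact: measurable_open_strip.
  (* The same [delta], equal to n^-2, serves both coordinates because m < n. *)
  have : delta <= m%:R ^- 2.
    rewrite lef_pV2 ?posrE ?exprn_gt0 // ler_pXn2r ?nnegrE ?ler0n // ler_nat.
    exact: ltnW.
  move: hy; rewrite in_itv /= => hy.
  by have := two_digits_inside m_gt1R (digit1_le b2) b12 hy; lra.
exists (bm_map a1 z); first exact: carpet_map.
have eD : delta / m%:R ^+ d.+1 = delta / m%:R ^+ d / m%:R by rewrite exprSr invfM mulrA.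
rewrite eD; split.
  by apply: affine_inside; rewrite ?digit1_le // divr_ge0 ?exprn_ge0 // ltW.
by rewrite prob_strip_bm // exprS ler_wpM2l // column_weight_ge0.
Qed.

(** The letters [c1], [c2], prepended to the point of [prob_strip_small], keep it off the horizontal
    sides; they shrink the width by m^2, whence the exponent [l + d + 2]. Then [a0] is prepended [l]
    times, each copy multiplying the mass by its weight. *)
Lemma prob_box_small l d : exists2 z, L z &
  prob (open_box z (delta / m%:R ^+ (l + d + 2)) (delta / n%:R ^+ l)) <=
    p a0 ^+ l * column_weight a1.1 ^+ d.
Proof.
suff [z Lz [_ _ h]] : exists2 z, L z & [/\
   delta / m%:R ^+ (l + d + 2) <= z.1 <= 1 - delta / m%:R ^+ (l + d + 2),
   delta / n%:R ^+ l <= z.2 <= 1 - delta / n%:R ^+ l &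
   prob (open_box z (delta / m%:R ^+ (l + d + 2)) (delta / n%:R ^+ l)) <=
    p a0 ^+ l * column_weight a1.1 ^+ d] by exists z.
have pos (b : R) k : 0 < b -> 0 <= delta / b ^+ k.
  by move=> b0; rewrite divr_ge0 ?exprn_ge0 // ltW.
have eD (b : R) k : delta / b ^+ k.+1 = delta / b ^+ k / b by rewrite exprSr invfM mulrA.
elim: l => [|l [z Lz [h1 h2 h3]]].
  have [z Lz [hz hP]] := prob_strip_small d.
  exists (bm_map c1 (bm_map c2 z)); first by do 2! apply: carpet_map => //.
  rewrite add0n addn2 !eD !expr0 divr1 mul1r.
  have hz2 : delta / m%:R ^+ d / m%:R <= (bm_map c2 z).1 <= 1 - delta / m%:R ^+ d / m%:R.
    by apply: affine_inside; rewrite ?digit1_le // pos.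
  split.
  - by apply: affine_inside; rewrite ?digit1_le // -eD pos.
  - have [/= _] := carpet_sub_square Lz; rewrite in_itv /=.
    exact: two_digits_inside n_gt1R (digit2_le c2) c12.
  - set s := delta / m%:R ^+ d in hz hP hz2 *.
    (* The two column weights of [c1] and [c2] are bounded by 1. *)
    apply: (@le_trans _ _ (prob (open_strip (bm_map c1 (bm_map c2 z)).1 (s / m%:R / m%:R)))).
      by apply: prob_le; [exact: measurable_open_box|exact: measurable_open_strip|move=> u []].
    rewrite prob_strip_bm // prob_strip_bm //.
    apply: le_trans hP; rewrite -[X in _ <= X]mul1r mulrA ler_wpM2r ?prob_ge0 //.
    by rewrite mulr_ile1 ?column_weight_ge0 ?column_weight_le1.
exists (bm_map a0 z); first exact: carpet_map.
rewrite !addSn !eD; split.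
- by apply: affine_inside; rewrite ?digit1_le // pos.
- by apply: affine_inside; rewrite ?digit2_le // pos.
- by rewrite prob_box_bm // exprS -mulrA ler_wpM2l // ltW // hp.1.
Qed.

End UpperBound.

End Measure.
End Carpet.

(** * Minkowski dimension *)

(* u is the least weight and v the least column weight. *)
Definition carpet_dim (R : realType) (m n : nat) (u v : R) : R :=
  ln u / (- ln n%:R) + (1 - log_ratio R m n) * (ln v / (- ln m%:R)).

Lemma expR_lnXM (R : realType) (u v : R) (l d : nat) : 0 < u -> 0 < v ->
  u ^+ l * v ^+ d = expR (l%:R * ln u + d%:R * ln v).
Proof.
by move=> u0 v0; rewrite expRD !expRM_natl !lnK ?posrE.
Qed.

(** * Choice of the two levels for a given radius *)

Section Scales.
Variables (R : realType) (m n : nat) (u v : R).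
Hypotheses (m_gt1 : (1 < m)%N) (mn : (m < n)%N).
Hypotheses (u0 : 0 < u) (u1 : u <= 1) (v0 : 0 < v) (v1 : v <= 1).

Let lnm : 0 < ln m%:R :> R. Proof. by rewrite ln_gt0 // ltr1n. Qed.
Let lnn : 0 < ln n%:R :> R. Proof. by rewrite ln_gt0 // ltr1n; lia. Qed.
Let lnmn : ln m%:R < ln n%:R :> R.
Proof. by rewrite ltr_ln ?posrE ?ltr_nat // ltr0n; lia. Qed.
Let lnu : ln u <= 0. Proof. exact: ln_le0. Qed.
Let lnv : ln v <= 0. Proof. exact: ln_le0. Qed.

(** With l = X / log n and d = X / log m - X / log n, this is - log (u^l v^d) / X, the exponent of
    the mass relative to the radius e^-X. *)
Lemma carpet_dimE : carpet_dim m n u v =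
  (ln n%:R)^-1 * (- ln u) + ((ln m%:R)^-1 - (ln n%:R)^-1) * (- ln v).
Proof.
rewrite /carpet_dim /log_ratio; field.
by rewrite !gt_eqF.
Qed.

Lemma carpet_dim_ge0 : 0 <= carpet_dim m n u v.
Proof.
rewrite carpet_dimE addr_ge0 // mulr_ge0 ?oppr_ge0 ?invr_ge0 ?(ltW lnn) //.
by rewrite subr_ge0 lef_pV2 ?posrE // ltW.
Qed.

Let D := carpet_dim m n u v.

(** Here [k] stands for l + d. Rounding moves [l] and [k] by at most 1 each, hence the exponents of
    [u] and [v] by at most 2; the resulting factor is bounded independently of [X]. *)
Lemma log_scales (X : R) (l k : nat) :
  X / ln n%:R - 1 <= l%:R <= X / ln n%:R + 1 ->
  X / ln m%:R - 1 <= k%:R <= X / ln m%:R + 1 -> (l <= k)%N ->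
  - (X * D) + 2 * (ln u + ln v) <= l%:R * ln u + (k - l)%:R * ln v <=
    - (X * D) - 2 * (ln u + ln v).
Proof.
move=> /andP[l1 l2] /andP[k1 k2] lk; rewrite natrB //.
have -> : X * D = X / ln n%:R * (- ln u) + (X / ln m%:R - X / ln n%:R) * (- ln v).
  by rewrite /D carpet_dimE; ring.
have h (e w : R) : -2 <= e <= 2 -> w <= 0 -> 2 * w <= e * w <= - (2 * w).
  by move=> /andP[e1 e2] w0; apply/andP; split; nra.
move: (X / ln n%:R) (X / ln m%:R) l1 l2 k1 k2 => a b l1 l2 k1 k2.
have /h/(_ lnu) : -2 <= l%:R - a <= 2 by apply/andP; split; lra.
have /h/(_ lnv) : -2 <= (k%:R - l%:R) - (b - a) <= 2 by apply/andP; split; lra.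
lra.
Qed.

(** The levels are rounded up, so that the box fits into the ball. The radius is halved because a
    square of half-side r / 2 has half-diagonal less than r. *)
Lemma exists_fine_scale (r : R) : 0 < r < 1 -> exists l d : nat,
  [/\ m%:R ^- (l + d) <= r / 2, n%:R ^- l <= r / 2 &
      expR (2 * (ln u + ln v) - D * ln 2) * r `^ D <= u ^+ l * v ^+ d].
Proof.
move=> /andP[r0 r1]; pose X := - ln (r / 2).
have r20 : 0 < r / 2 by lra.
have X0 : 0 < X by rewrite oppr_gt0 ln_lt0 // r20 /=; lra.
have XE : X = ln 2 - ln r by rewrite /X ln_div ?posrE // opprB.
have scale (b : nat) : 0 < ln b%:R :> R -> (0 < b)%N -> exists2 k : nat,
    X / ln b%:R - 1 <= k%:R <= X / ln b%:R + 1 & X / ln b%:R < k%:R.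
  move=> lb b0; exists (Num.truncn (X / ln b%:R)).+1.
    have /andP[] := Num.Theory.truncn_itv (ltW (divr_gt0 X0 lb)); rewrite -natr1; lra.
  by have /andP[] := Num.Theory.truncn_itv (ltW (divr_gt0 X0 lb)).
have small (b k : nat) : 0 < ln b%:R :> R -> (0 < b)%N -> X / ln b%:R < k%:R ->
    (b%:R : R) ^- k <= r / 2.
  move=> lb b0 h; rewrite -(lnK (r20 : r / 2 \is Num.pos)) -[ln _]opprK -/X expRN.
  rewrite lef_pV2 ?posrE ?expR_gt0 ?exprn_gt0 ?ltr0n //.
  rewrite -[X in _ <= X ^+ _](@lnK _ b%:R) ?posrE ?ltr0n // -expRM_natl ler_expR.
  by rewrite -ler_pdivrMr // ltW.
have [k k1 k2] := scale m lnm (ltnW m_gt1).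
have [l l1 l2] := scale n lnn (leq_ltn_trans (leq0n _) mn).
have lk : (l <= k)%N.
  rewrite -ltnS -(ltr_nat R) -natr1.
  have : X / ln n%:R <= X / ln m%:R by rewrite ler_pM2l // lef_pV2 ?posrE // ltW.
  by move: l1 => /andP[_ ?]; lra.
exists l, (k - l)%N; rewrite subnKC //; split.
- exact: small (ltnW m_gt1) k2.
- exact: small (leq_ltn_trans (leq0n _) mn) l2.
- rewrite expR_lnXM // /powR gt_eqF // -expRD ler_expR.
  have := log_scales l1 k1 lk; rewrite XE -/D => /andP[h _].
  by apply: le_trans h; lra.
Qed.

(** The levels are rounded down, so that the box contains the ball. The factor [e] makes room for
    [delta] and for the two extra levels of [prob_box_small]. *)
Lemma exists_coarse_scale (r e : R) : 0 < r <= e -> exists l d : nat,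
  [/\ r <= e / m%:R ^+ (l + d), r <= e / n%:R ^+ l &
      u ^+ l * v ^+ d <= expR (- 2 * (ln u + ln v) - D * ln e) * r `^ D].
Proof.
move=> /andP[r0 re]; have e0 := lt_le_trans r0 re.
pose X := ln (e / r).
have er0 : 0 < e / r by rewrite divr_gt0.
have X0 : 0 <= X by rewrite ln_ge0 // ler_pdivlMr // mul1r.
have XE : X = ln e - ln r by rewrite /X ln_div ?posrE.
have scale (b : nat) : 0 < ln b%:R :> R -> exists2 k : nat,
    X / ln b%:R - 1 <= k%:R <= X / ln b%:R + 1 &
    k = Num.truncn (X / ln b%:R) /\ k%:R <= X / ln b%:R.
  move=> lb; have h : 0 <= X / ln b%:R by rewrite divr_ge0 // ltW.
  exists (Num.truncn (X / ln b%:R)); last by split=> //; have /andP[] := Num.Theory.truncn_itv h.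
  have /andP[] := Num.Theory.truncn_itv h; rewrite -natr1; lra.
have small (b k : nat) : 0 < ln b%:R :> R -> (0 < b)%N -> k%:R <= X / ln b%:R ->
    r <= e / b%:R ^+ k.
  move=> lb b0; rewrite ler_pdivlMr // => h.
  rewrite ler_pdivlMr ?exprn_gt0 ?ltr0n // mulrC -ler_pdivlMr //.
  rewrite -(lnK (er0 : e / r \is Num.pos)) -/X.
  by rewrite -[X in X ^+ _ <= _](@lnK _ b%:R) ?posrE ?ltr0n // -expRM_natl ler_expR.
have [k k1 [kE k2]] := scale m lnm.
have [l l1 [lE l2]] := scale n lnn.
have lk : (l <= k)%N.
  rewrite lE kE Num.Theory.le_truncn // ler_wpM2l // lef_pV2 ?posrE //.
  exact: ltW.
exists l, (k - l)%N; rewrite subnKC //; split.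
- exact: small (ltnW m_gt1) k2.
- exact: small (leq_ltn_trans (leq0n _) mn) l2.
- rewrite expR_lnXM // /powR gt_eqF // -expRD ler_expR.
  have := log_scales l1 k1 lk; rewrite XE -/D => /andP[_ h].
  by apply: (le_trans h); lra.
Qed.

End Scales.

(** * Comparison of Euclidean balls with boxes *)

Section Balls.
Variables (R : realType) (X : set (R * R)).

Lemma edist_lt (x y : R * R) (r : R) : 0 < r ->
  (Defs.edist x y < r) = ((x.1 - y.1) ^+ 2 + (x.2 - y.2) ^+ 2 < r ^+ 2).
Proof.
move=> r0; rewrite /Defs.edist -[X in _ < X]ger0_norm ?(ltW r0) // -sqrtr_sqr.
by rewrite ltr_sqrt // exprn_gt0.
Qed.

Lemma measurable_eball x r : measurable X -> 0 < r -> measurable (eball X x r).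
Proof.
move=> mX r0; apply: measurableI => //.
pose f (y : R * R) := (x.1 - y.1) ^+ 2 + (x.2 - y.2) ^+ 2.
have mf : measurable_fun setT f.
  by apply: measurable_funD; apply: measurable_funX; apply: measurable_funB.
rewrite (_ : [set y | _] = f @^-1` `]-oo, r ^+ 2[).
  by rewrite -[X in measurable X]setTI; apply: mf => //; exact: measurable_itv.
by apply/seteqP; split=> y; rewrite /= in_itv /= edist_lt.
Qed.

Lemma closed_box_eball x (s t r : R) : 0 < r -> s <= r / 2 -> t <= r / 2 ->
  closed_box x s t `&` X `<=` eball X x r.
Proof.
move=> r0 sr tr y [[/= h1 h2] Xy]; split=> //=; rewrite edist_lt //.
have sq (a b : R) : `|b - a| <= r / 2 -> (a - b) ^+ 2 <= (r / 2) ^+ 2.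
  by move=> h; rewrite -sqrrN opprB -[X in X <= _]real_normK ?num_real // ler_pXn2r ?nnegrE //; lra.
have := sq _ _ (le_trans h1 sr); have := sq _ _ (le_trans h2 tr); nra.
Qed.

Lemma eball_open_box x (s t r : R) : 0 < r -> r <= s -> r <= t ->
  eball X x r `<=` open_box x s t.
Proof.
move=> r0 rs rt y [_ /=]; rewrite edist_lt // => h.
have sq (a b c : R) : (a - b) ^+ 2 < r ^+ 2 -> r <= c -> `|b - a| < c.
  move=> h2 rc; apply: lt_le_trans rc; rewrite distrC.
  by rewrite -(ltr_pXn2r (n := 2)) ?nnegrE ?(ltW r0) // real_normK ?num_real.
have := sqr_ge0 (x.1 - y.1); have := sqr_ge0 (x.2 - y.2) => h1 h2.
by split=> /=; [apply: (sq x.1)|apply: (sq x.2)] => //; lra.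
Qed.

End Balls.

Lemma powR_le_exponent (R : realType) (c C s D : R) (r : nat -> R) : 0 < c -> 0 < C ->
  (forall j, 0 < r j) -> r @ \oo --> (0 : R) ->
  (\forall j \near \oo, c * r j `^ s <= C * r j `^ D) -> D <= s.
Proof.
move=> c0 C0 r_gt0 r0 h; rewrite leNgt; apply/negP => sD.
(* This is (c / C)^(1 / (D - s)): for r below it, C r^D < c r^s. *)
pose e := expR (ln (c / C) / (D - s)).
have e0 : 0 < e by exact: expR_gt0.
have hr : \forall j \near \oo, r j < e.
  move/cvgrPdist_lt: r0 => /(_ _ e0); apply: filterS => j.
  by rewrite sub0r normrN ger0_norm // ltW.
have [j [hj]] : exists j, c * r j `^ s <= C * r j `^ D /\ r j < e.
  by apply: (@filter_ex _ \oo); near=> j; split; near: j.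
rewrite -ltr_ln ?posrE // expRK ltr_pdivlMr ?subr_gt0 //.
rewrite ln_div ?posrE //; move: hj.
rewrite /powR !gt_eqF // -ler_ln ?posrE ?mulr_gt0 ?expR_gt0 // !lnM ?posrE ?expR_gt0 // !expRK.
by move=> ? ?; lra.
Unshelve. all: by end_near. Qed.

(** * The dimension formula *)

Section Dimension.
Variables (R : realType) (m n : nat) (A : {set 'I_m * 'I_n}) (L : set (R * R)).
Hypotheses (m_gt1 : (1 < m)%N) (mn : (m < n)%N) (hL : is_carpet A L).
Variables (p : 'I_m * 'I_n -> R) (nu : probability (R * R)%type R).
Hypotheses (hp : nondegenerate_weights A p) (hnu : is_self_affine A p nu).
Variables (a0 a1 b1 b2 c1 c2 : 'I_m * 'I_n).
Hypotheses (a0A : a0 \in A) (a1A : a1 \in A) (b1A : b1 \in A) (b2A : b2 \in A)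
  (c1A : c1 \in A) (c2A : c2 \in A).
Hypotheses (b12 : (b1.1 < b2.1)%N) (c12 : (c1.2 < c2.2)%N).
Hypotheses (min0 : forall a, a \in A -> p a0 <= p a)
  (min1 : forall a, a \in A -> column_weight A p a1.1 <= column_weight A p a.1).

Let u : R := p a0.
Let v : R := column_weight A p a1.1.
Let D : R := carpet_dim m n u v.

Let u0 : 0 < u. Proof. exact: hp.1. Qed.

Let v0 : 0 < v.
Proof.
rewrite /v /column_weight (bigD1 a1) ?a1A ?eqxx //=.
by rewrite ltr_pwDl ?hp.1 // sumr_ge0 // => a /andP[/andP[aA _] _]; exact/ltW/hp.1.
Qed.

Let v1 : v <= 1. Proof. exact: column_weight_le1. Qed.

Let u1 : u <= 1.
Proof.
apply: le_trans (column_weight_le1 hp a0.1); rewrite /column_weight.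
rewrite (bigD1 a0) ?a0A ?eqxx //= lerDl.
by rewrite sumr_ge0 // => a /andP[/andP[aA _] _]; exact/ltW/hp.1.
Qed.

Let mL : measurable L. Proof. exact: measurable_carpet m_gt1 mn hL. Qed.

Lemma eball_ge : exists2 c : R, 0 < c & forall (x : R * R) (r : R), L x ->
  0 < r < 1 -> ((c * r `^ D)%:E <= nu (eball L x r))%E.
Proof.
exists (expR (2 * (ln u + ln v) - D * ln 2)); first exact: expR_gt0.
move=> x r Lx r01; have /andP[r0 _] := r01.
have [l [d [h1 h2 h3]]] := exists_fine_scale m_gt1 mn u0 u1 v0 v1 r01.
rewrite (probE _ (measurable_eball _ mL r0)) lee_fin; apply: (le_trans h3).
apply: (le_trans (prob_box_ge m_gt1 mn hL hp hnu (ltW u0) min0 (ltW v0) min1 l d Lx)).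
rewrite -(prob_full (measurable_closed_box _ _ _) mL (prob_carpet m_gt1 mn hL hp hnu)).
apply: prob_le; [|exact: measurable_eball|exact: closed_box_eball].
by apply: measurableI => //; exact: measurable_closed_box.
Qed.

Lemma eball_le : exists2 C : R, 0 < C & exists2 e : R, 0 < e & forall r : R,
  0 < r <= e -> exists2 x, L x & (nu (eball L x r) <= (C * r `^ D)%:E)%E.
Proof.
have m_gt0 : (0 < m)%N := ltnW m_gt1.
have n_gt0 : (0 < n)%N := leq_ltn_trans (leq0n _) mn.
pose delta : R := n%:R ^- 2; pose e := delta / m%:R ^+ 2.
have d0 : 0 < delta by rewrite invr_gt0 exprn_gt0 // ltr0n.
have m2 : 1 <= m%:R ^+ 2 :> R by rewrite exprn_ege1 // ler1n.
have e0 : 0 < e by rewrite divr_gt0 // (lt_le_trans ltr01).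
exists (expR (- 2 * (ln u + ln v) - D * ln e)); first exact: expR_gt0.
exists e => // r re; have /andP[r0 _] := re.
have [l [d [h1 h2 h3]]] := exists_coarse_scale m_gt1 mn u0 u1 v0 v1 re.
have [x Lx hx] := prob_box_small m_gt1 mn hL hp hnu a0A a1A b1A b2A c1A c2A b12 c12 l d.
exists x => //; rewrite (probE _ (measurable_eball _ mL r0)) lee_fin.
apply: le_trans h3; apply: le_trans hx.
apply: prob_le; [exact: measurable_eball|exact: measurable_open_box|].
apply: eball_open_box => //.
  by rewrite exprD [(_ * m%:R ^+ 2)^-1]invfM mulrA mulrAC.
apply: (le_trans h2); rewrite ler_pM2r ?invr_gt0 ?exprn_gt0 ?ltr0n //.
by rewrite /e ler_pdivrMr ?(lt_le_trans ltr01 m2) // ler_peMr // ltW.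
Qed.

(** [eball_ge] bounds the upper dimension by [D]. [eball_le] provides a light ball at every small
    radius, hence along every sequence of radii, and so bounds the lower dimension from below. *)
Lemma self_affine_minkowski_dim : has_minkowski_dim L nu D%:E.
Proof.
have D0 : 0 <= D by exact: carpet_dim_ge0.
have [c c0 hc] := eball_ge; have [C C0 [e e0 hC]] := eball_le.
have upper : (upper_minkowski_dim L nu <= D%:E)%E.
  by apply: ereal_inf_lbound; exists D => //; split=> //; exists c.
have lower : (D%:E <= lower_minkowski_dim L nu)%E.
  apply: le_ereal_inf_tmp => _ [s [s0 [c' [r [c'0 r_gt0 r0 hr]]]] <-].
  rewrite lee_fin; apply: (powR_le_exponent c'0 C0 r_gt0 r0).
  move/cvgrPdist_le: r0 => /(_ _ e0); apply: filterS => j.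
  rewrite sub0r normrN ger0_norm ?(ltW (r_gt0 j)) // => re.
  have [|x Lx hx] := hC (r j); first by rewrite r_gt0.
  by rewrite -lee_fin; apply: le_trans hx; exact: hr.
have lu : (lower_minkowski_dim L nu <= upper_minkowski_dim L nu)%E.
  apply: le_ereal_inf => _ [s [s0 [c' c'0 hs]] <-]; exists s => //; split=> //.
  (* The shift by 2 keeps every radius below 1, the range of the upper dimension. *)
  exists c', (fun j => j.+2%:R^-1); split=> //.
  - by rewrite (cvg_shiftS (@harmonic R)); exact: cvg_harmonic.
  - move=> x j Lx; apply: hs => //; rewrite invr_gt0 ltr0n /=.
    by rewrite invf_lt1 ?ltr1n // ltr0n.
by split; apply/eqP; rewrite eq_le; apply/andP; split=> //;
  [exact: le_trans lu|exact: le_trans upper].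
Qed.

End Dimension.

(** * Optimisation over Q *)

Lemma exists_min_val disp (O : orderType disp) (T : finType) (P : pred T) (f : T -> O) i0 :
  P i0 -> exists2 i, P i & forall j, P j -> (f i <= f j)%O.
Proof. by move=> Pi0; case: (Order.TotalTheory.arg_minP f Pi0) => i Pi h; exists i. Qed.

(** * Classes of columns of equal size *)

Section ColumnClasses.
Variables (m n : nat) (A : {set 'I_m * 'I_n}).

Lemma col_sizes_sorted : sorted ltn (col_sizes A).
Proof.
by rewrite ltn_sorted_uniq_leq sort_uniq undup_uniq sort_sorted //; exact: leq_total.
Qed.

Lemma ltn_Nk (k l : 'I_(M0 A)) : (Nk k < Nk l)%N = (k < l)%N.
Proof.
have mono (x y : 'I_(M0 A)) : (x < y)%N -> (Nk x < Nk y)%N.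
  by move=> xy; apply: (sorted_ltn_nth ltn_trans 0%N col_sizes_sorted); rewrite ?inE.
have [/mono -> //|lk|/val_inj ->] := ltngtP k l; last by rewrite ltnn.
by rewrite ltnNge ltnW // mono.
Qed.

Lemma leq_Nk (k l : 'I_(M0 A)) : (Nk k <= Nk l)%N = (k <= l)%N.
Proof. by rewrite leqNgt ltn_Nk -leqNgt. Qed.

Lemma Nk_inj : injective (@Nk m n A).
Proof.
move=> k l e; apply: val_inj; apply/eqP; rewrite eqn_leq -!leq_Nk e leqnn //.
Qed.

Lemma mem_col_sizes x : (x \in col_sizes A) = (0 < x)%N && [exists i, col_count A i == x].
Proof.
rewrite mem_sort mem_undup; apply/mapP/andP => [[i]|[x0 /existsP[i /eqP ix]]].
  by rewrite mem_filter => /andP[h _] ->; split=> //; apply/existsP; exists i.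
by exists i; rewrite // mem_filter ix x0 mem_enum.
Qed.

Lemma Nk_mem (k : 'I_(M0 A)) : Nk k \in col_sizes A.
Proof. exact: mem_nth. Qed.

Lemma Nk_gt0 (k : 'I_(M0 A)) : (0 < Nk k)%N.
Proof. by have := Nk_mem k; rewrite mem_col_sizes => /andP[]. Qed.

Lemma Nk_column (k : 'I_(M0 A)) : exists i, col_count A i = Nk k.
Proof. by have := Nk_mem k; rewrite mem_col_sizes => /andP[_ /existsP[i /eqP]]; exists i. Qed.

Lemma column_class i : (0 < col_count A i)%N -> exists k : 'I_(M0 A), col_count A i = Nk k.
Proof.
move=> i0; have : col_count A i \in col_sizes A.
  by rewrite mem_col_sizes i0; apply/existsP; exists i.
by move=> /(nthP 0%N)[k hk <-]; exists (Ordinal hk).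
Qed.

Lemma Rk_gt0 (k : 'I_(M0 A)) : (0 < Rk k)%N.
Proof. by have [i ik] := Nk_column k; apply/card_gt0P; exists i; rewrite inE; apply/eqP. Qed.

Lemma col_count_gt0 a : a \in A -> (0 < col_count A a.1)%N.
Proof. by case: a => i j aA; apply/card_gt0P; exists j; rewrite inE. Qed.

Lemma column_element (k : 'I_(M0 A)) : exists2 a, a \in A & col_count A a.1 = Nk k.
Proof.
have [i ik] := Nk_column k; have := Nk_gt0 k; rewrite -ik => /card_gt0P[j].
by rewrite inE => ijA; exists (i, j).
Qed.

Lemma Rcard_gt0 (K : 'I_(M0 A)) : (0 < Rcard K)%N.
Proof. by rewrite /Rcard (bigD1 K) //= addn_gt0 Rk_gt0. Qed.

Lemma Rcompl_gt0 (K : 'I_(M0 A)) : (0 < Rcompl K)%N = (K.+1 < M0 A)%N.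
Proof.
have [h|h] := ltnP K.+1 (M0 A).
  by rewrite /Rcompl (bigD1 (Ordinal h)) //= addn_gt0 muln_gt0 Rk_gt0 Nk_gt0.
by rewrite /Rcompl big1 // => k; have := ltn_ord k; lia.
Qed.

(** The class [K'] contributes R_K' N_K' whether it is counted in [Rcard] with factor N_K' or in
    [Rcompl]. So consecutive linear pieces of the constraint agree at their common breakpoint. *)
Lemma Rsum_succ (K K' : 'I_(M0 A)) : K' = K.+1 :> nat ->
  (Nk K' * Rcard K' + Rcompl K' = Nk K' * Rcard K + Rcompl K)%N.
Proof.
move=> KE.
have -> : Rcard K' = (Rcard K + Rk K')%N.
  rewrite /Rcard (bigD1 K') //= addnC; congr addn; apply: eq_bigl => k.
  by rewrite -(inj_eq val_inj) /= KE; apply/idP/idP; lia.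
have -> : Rcompl K = (Rcompl K' + Rk K' * Nk K')%N.
  rewrite /Rcompl [LHS](bigD1 K') ?KE //= addnC; congr addn; apply: eq_bigl => k.
  by rewrite -(inj_eq val_inj) /= KE; apply/idP/idP; lia.
by lia.
Qed.

Variable R : realType.

Lemma sum_column i (F : 'I_m * 'I_n -> R) :
  \sum_(a in A | a.1 == i) F a = \sum_(j | (i, j) \in A) F (i, j).
Proof.
rewrite (eq_bigl (fun a => (a.1 == i) && ((a.1, a.2) \in A))); last first.
  by case=> x y; rewrite andbC.
rewrite (eq_bigr (fun a => F (a.1, a.2))); last by case.
rewrite -(pair_big_dep (fun x => x == i) (fun x j => (x, j) \in A) (fun x j => F (x, j))) /=.
by rewrite big_pred1_eq.
Qed.

Lemma column_weight_const (p : 'I_m * 'I_n -> R) i (c : R) :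
  (forall a, a \in A -> a.1 = i -> p a = c) -> column_weight A p i = (col_count A i)%:R * c.
Proof.
move=> pc; rewrite /column_weight (eq_bigr (fun=> c)); last first.
  by move=> a /andP[aA /eqP ai]; exact: pc.
rewrite sum_column sumr_const /col_count mulr_natl; congr (_ *+ _).
by apply: eq_card => j; apply/idP/idP => [h|/set_mem h]; [exact/mem_set|exact: h].
Qed.

Lemma column_weight_ge (p : 'I_m * 'I_n -> R) i (c : R) :
  (forall a, a \in A -> c <= p a) -> (col_count A i)%:R * c <= column_weight A p i.
Proof.
move=> pc; rewrite -(@column_weight_const (fun=> c)) //.
by apply: ler_sum => a /andP[aA _]; exact: pc.
Qed.

(** Letters are grouped by column and columns by class; the empty columns carry no weight. *)
Lemma sum_column_weight (p : 'I_m * 'I_n -> R) :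
  \sum_(a in A) p a = \sum_(k < M0 A) \sum_(i | col_count A i == Nk k) column_weight A p i.
Proof.
rewrite (partition_big fst xpredT) //= [RHS](exchange_big_dep xpredT) //=.
apply: eq_bigr => i _; rewrite -/(column_weight A p i).
have [i0|i0] := posnP (col_count A i).
  have -> : column_weight A p i = 0.
    rewrite /column_weight big_pred0 // => a.
    apply/negP => /andP[/col_count_gt0 h /eqP ai]; move: h.
    by have -> : col_count A a.1 = 0%N by rewrite -i0; congr col_count.
  by rewrite big1.
have [k ik] := column_class i0.
rewrite (big_pred1 k) // => l; rewrite ik /=.
by apply/eqP/eqP => [/Nk_inj|->].
Qed.

Lemma sum_class (k : 'I_(M0 A)) (c : R) :
  \sum_(i | col_count A i == Nk k) c = (Rk k)%:R * c.
Proof.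
rewrite sumr_const mulr_natl; congr (_ *+ _).
by apply: eq_card => i; apply/idP/idP => [h|/set_mem h]; [exact/mem_set|exact: h].
Qed.

End ColumnClasses.

(** * Values of [alpha] at the candidates *)

Section Optimum.
Variables (R : realType) (m n : nat) (A : {set 'I_m * 'I_n}).
Hypotheses (m_gt1 : (1 < m)%N) (mn : (m < n)%N).

Let lnm : 0 < ln m%:R :> R. Proof. by rewrite ln_gt0 // ltr1n. Qed.
Let lnn : 0 < ln n%:R :> R. Proof. by rewrite ln_gt0 // ltr1n; lia. Qed.
Let lnmn : ln m%:R < ln n%:R :> R.
Proof. by rewrite ltr_ln ?posrE ?ltr_nat // ltr0n; lia. Qed.

Let theta : R := log_ratio R m n.

Let theta_gt0 : 0 < theta. Proof. exact: divr_gt0. Qed.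
Let theta_lt1 : theta < 1. Proof. by rewrite ltr_pdivrMr // mul1r. Qed.

Lemma carpet_dim_log (u v : R) :
  carpet_dim m n u v = - (theta * ln u + (1 - theta) * ln v) / ln m%:R.
Proof.
by rewrite /carpet_dim /theta /log_ratio; field; rewrite !gt_eqF.
Qed.

(* The tangent inequality ln x <= x - 1 at (u0, v0), i.e. concavity of the logarithm. *)
Lemma carpet_dim_tangent (u v u0 v0 : R) : 0 < u -> 0 < v -> 0 < u0 -> 0 < v0 ->
  theta * (u / u0) + (1 - theta) * (v / v0) <= 1 ->
  carpet_dim m n u0 v0 <= carpet_dim m n u v.
Proof.
move=> u_gt0 v_gt0 u0_gt0 v0_gt0 h.
rewrite !carpet_dim_log ler_pM2r ?invr_gt0 // lerN2.
have ln_le (x y : R) : 0 < x -> 0 < y -> ln x - ln y <= x / y - 1.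
  move=> x0 y0; rewrite -ln_div ?posrE //.
  have e : 1 + (x / y - 1) = x / y by ring.
  have := @le_ln1Dx R (x / y - 1); rewrite e; apply.
  by rewrite ltrBrDl subrr divr_gt0.
have t0 := theta_gt0; have t1 := theta_lt1.
have : theta * (ln u - ln u0) <= theta * (u / u0 - 1) by rewrite ler_pM2l // ln_le.
have : (1 - theta) * (ln v - ln v0) <= (1 - theta) * (v / v0 - 1).
  by rewrite ler_pM2l ?subr_gt0 // ln_le.
lra.
Qed.

Lemma carpet_dim_le (u v u0 v0 : R) : 0 < u -> 0 < v -> u <= u0 -> v <= v0 ->
  carpet_dim m n u0 v0 <= carpet_dim m n u v.
Proof.
move=> u_gt0 v_gt0 uu0 vv0.
have u0_gt0 := lt_le_trans u_gt0 uu0; have v0_gt0 := lt_le_trans v_gt0 vv0.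
apply: carpet_dim_tangent => //.
have h1 : u / u0 <= 1 by rewrite ler_pdivrMr // mul1r.
have h2 : v / v0 <= 1 by rewrite ler_pdivrMr // mul1r.
have t0 := theta_gt0; have t1 := theta_lt1; nra.
Qed.

Lemma alpha_le (q : 'I_(M0 A) -> R) (u v : R) : 0 < u -> 0 < v ->
  (forall k, u <= q k / (Nk k)%:R) -> (forall l, v <= q l) ->
  (alpha q <= (carpet_dim m n u v)%:E)%E.
Proof.
move=> u0 v0 hu hv; apply/bigmax_leP; split; first by rewrite leNye.
move=> k _; apply/bigmax_leP; split; first by rewrite leNye.
by move=> l _; rewrite lee_fin; exact: carpet_dim_le.
Qed.

Lemma alpha_ge (q : 'I_(M0 A) -> R) k l :
  ((carpet_dim m n (q k / (Nk k)%:R) (q l))%:E <= alpha q)%E.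
Proof.
apply: le_trans (le_bigmax _ _ k); exact: le_bigmax _ _ l.
Qed.

(** The two indices of [alpha] vary independently and [carpet_dim] decreases in each argument, so
    the maximum is at the two minima. *)
Lemma alphaE (q : 'I_(M0 A) -> R) k l : (forall k, 0 < q k) ->
  (forall k', q k / (Nk k)%:R <= q k' / (Nk k')%:R) -> (forall l', q l <= q l') ->
  alpha q = (carpet_dim m n (q k / (Nk k)%:R) (q l))%:E.
Proof.
move=> q0 hk hl; apply/eqP; rewrite eq_le alpha_ge andbT; apply: alpha_le => //.
by rewrite divr_gt0 // ltr0n Nk_gt0.
Qed.

Let S (K : 'I_(M0 A)) : R := (Nk K)%:R * (Rcard K)%:R + (Rcompl K)%:R.

Let S_gt0 K : 0 < S K.
Proof. by rewrite ltr_pwDl // mulr_gt0 // ltr0n ?Nk_gt0 ?Rcard_gt0. Qed.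

Lemma sum_split (K : 'I_(M0 A)) (f g : 'I_(M0 A) -> R) :
  \sum_(k < M0 A) (Rk k)%:R * (if (k <= K)%N then f k else g k) =
  \sum_(k < M0 A | (k <= K)%N) (Rk k)%:R * f k +
  \sum_(k < M0 A | (K < k)%N) (Rk k)%:R * g k.
Proof.
rewrite (bigID (fun k : 'I_(M0 A) => (k <= K)%N)) /=; congr (_ + _).
  by apply: eq_bigr => k ->.
rewrite (eq_bigl (fun k : 'I_(M0 A) => (K < k)%N)) => [|k]; last by rewrite -ltnNge.
by apply: eq_bigr => k; rewrite ltnNge => /negbTE ->.
Qed.

Let RcardE (K : 'I_(M0 A)) : (Rcard K)%:R = \sum_(k < M0 A | (k <= K)%N) (Rk k)%:R :> R.
Proof. by rewrite /Rcard natr_sum. Qed.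

Lemma small_q_Qset K : Qset R A (small_q R K).
Proof.
split=> [|k]; last first.
  by rewrite /small_q divr_gt0 ?S_gt0 //; case: ifP; rewrite ltr0n Nk_gt0.
transitivity (S K / S K); last by rewrite divff // gt_eqF.
rewrite /small_q -/(S K); under eq_bigr do rewrite mulrA.
rewrite -mulr_suml; congr (_ / _); rewrite (sum_split K (fun=> (Nk K)%:R) (fun k => (Nk k)%:R)) /S; congr (_ + _).
  by rewrite -mulr_suml mulrC -RcardE.
by rewrite /Rcompl natr_sum; apply: eq_bigr => k _; rewrite natrM.
Qed.

Lemma big_q_Qset (K : 'I_(M0 A)) : (K.+1 < M0 A)%N -> Qset R A (big_q R K).
Proof.
move=> hK; have a0 : 0 < (Rcard K)%:R :> R by rewrite ltr0n Rcard_gt0.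
have b0 : 0 < (Rcompl K)%:R :> R by rewrite ltr0n Rcompl_gt0.
split=> [|k]; last first.
  rewrite /big_q; case: ifP => _; first by rewrite divr_gt0 // subr_gt0.
  by rewrite mulr_gt0 // divr_gt0 // ltr0n Nk_gt0.
rewrite /big_q (sum_split K (fun=> (1 - log_ratio R m n) / (Rcard K)%:R)
  (fun k => log_ratio R m n * ((Nk k)%:R / (Rcompl K)%:R))) -mulr_suml -RcardE.
rewrite mulrC divfK ?gt_eqF //.
have -> : \sum_(k < M0 A | (K < k)%N) (Rk k)%:R * (log_ratio R m n * ((Nk k)%:R / (Rcompl K)%:R))
    = theta / (Rcompl K)%:R * (Rcompl K)%:R.
  rewrite [in RHS]/Rcompl natr_sum mulr_sumr; apply: eq_bigr => k _.
  by rewrite natrM /theta; ring.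
by rewrite divfK ?gt_eqF // /theta; ring.
Qed.

(** In the sum of the R_k q_k, bound q_k below by [v] for k <= K and by u N_k for k > K. *)
Lemma Qset_constraint (q : 'I_(M0 A) -> R) (u v : R) (K : 'I_(M0 A)) : Qset R A q ->
  (forall k, u <= q k / (Nk k)%:R) -> (forall l, v <= q l) ->
  v * (Rcard K)%:R + u * (Rcompl K)%:R <= 1.
Proof.
move=> [q1 _] hu hv; rewrite -[X in _ <= X]q1.
have -> : v * (Rcard K)%:R + u * (Rcompl K)%:R =
    \sum_(k < M0 A) (Rk k)%:R * (if (k <= K)%N then v else u * (Nk k)%:R).
  rewrite (sum_split K (fun=> v) (fun k => u * (Nk k)%:R)); congr (_ + _).
    by rewrite -mulr_suml -RcardE mulrC.
  rewrite /Rcompl natr_sum mulr_sumr; apply: eq_bigr => k _.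
  by rewrite natrM; ring.
apply: ler_sum => k _; rewrite ler_wpM2l //; case: ifP => // _.
by rewrite -ler_pdivlMr // ltr0n Nk_gt0.
Qed.

(* At the breakpoint N_K the coefficients (a, b) of both adjacent linear pieces
   t -> a t + b of the constraint are admissible. *)
Lemma alpha_small_q (K : 'I_(M0 A)) (u v a b : R) : 0 < u -> 0 < v ->
  (Nk K)%:R * (Rcard K)%:R + (Rcompl K)%:R = (Nk K)%:R * a + b ->
  v * a + u * b <= 1 ->
  0 <= (v - u * (Nk K)%:R) * (theta * a * (Nk K)%:R - (1 - theta) * b) ->
  (alpha (small_q R K) <= (carpet_dim m n u v)%:E)%E.
Proof.
move=> u0 v0 SE h1 h2; have N0 : 0 < (Nk K)%:R :> R by rewrite ltr0n Nk_gt0.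
(* These two arguments bound the weights and the column weights of [small_q] from below; their ratio
   is the breakpoint N_K. *)
apply: (@le_trans _ _ (carpet_dim m n (1 / S K) ((Nk K)%:R / S K))%:E).
  apply: alpha_le => [||k|k]; rewrite ?divr_gt0 //.
    have Nk0 : 0 < (Nk k)%:R :> R by rewrite ltr0n Nk_gt0.
    rewrite /small_q -/(S K) mulrAC ler_pM2r ?invr_gt0 // ler_pdivlMr // mul1r.
    by case: ifP => // kK; rewrite ler_nat leq_Nk.
  rewrite /small_q -/(S K) ler_pM2r ?invr_gt0 //; case: ifP => // kK.
  by rewrite ler_nat leq_Nk ltnW // ltnNge kK.
rewrite lee_fin; apply: carpet_dim_tangent; rewrite ?divr_gt0 //.
rewrite !invf_div divr1 /S SE.
(* The tangent expression at the breakpoint is v a + u b minus a term that the sign hypothesis makes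
   non-negative. *)
have -> : theta * (u * ((Nk K)%:R * a + b)) +
    (1 - theta) * (v * (((Nk K)%:R * a + b) / (Nk K)%:R)) =
    v * a + u * b - (v - u * (Nk K)%:R) *
    (theta * a * (Nk K)%:R - (1 - theta) * b) / (Nk K)%:R.
  by field; rewrite gt_eqF.
apply: le_trans h1; rewrite gerBl divr_ge0 //; exact: ltW.
Qed.

(** The last two hypotheses place the ratio v / u of the maximiser (theta / b, (1 - theta) / a)
    between N_K and N_K'. This makes its coordinates lower bounds for the weights and column weights
    of [big_q]; the tangent expression there is exactly v a + u b. *)
Lemma alpha_big_q (K K' : 'I_(M0 A)) (u v : R) : K' = K.+1 :> nat -> 0 < u -> 0 < v ->
  v * (Rcard K)%:R + u * (Rcompl K)%:R <= 1 ->
  theta * (Rcard K)%:R * (Nk K)%:R <= (1 - theta) * (Rcompl K)%:R ->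
  (1 - theta) * (Rcompl K)%:R <= theta * (Rcard K)%:R * (Nk K')%:R ->
  (alpha (big_q R K) <= (carpet_dim m n u v)%:E)%E.
Proof.
move=> KE u0 v0 h1 h2 h3.
have a0 : 0 < (Rcard K)%:R :> R by rewrite ltr0n Rcard_gt0.
have b0 : 0 < (Rcompl K)%:R :> R by rewrite ltr0n Rcompl_gt0 -KE.
have t1 : 0 < 1 - theta by rewrite subr_gt0.
have key (x : R) : (theta / (Rcompl K)%:R * x <= (1 - theta) / (Rcard K)%:R) =
    (theta * (Rcard K)%:R * x <= (1 - theta) * (Rcompl K)%:R).
  rewrite (_ : theta / _ * x = theta * x / (Rcompl K)%:R); last by ring.
  by rewrite ler_pdivlMr // mulrAC ler_pdivrMr // mulrAC.
have key' (x : R) : ((1 - theta) / (Rcard K)%:R <= theta / (Rcompl K)%:R * x) =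
    ((1 - theta) * (Rcompl K)%:R <= theta * (Rcard K)%:R * x).
  rewrite (_ : theta / _ * x = theta * x / (Rcompl K)%:R); last by ring.
  by rewrite ler_pdivrMr // mulrAC ler_pdivlMr // mulrAC.
apply: (@le_trans _ _ (carpet_dim m n (theta / (Rcompl K)%:R) ((1 - theta) / (Rcard K)%:R))%:E).
  apply: alpha_le => [||k|k]; rewrite ?divr_gt0 // /big_q; case: ifP => kK.
  - have Nk0 : 0 < (Nk k)%:R :> R by rewrite ltr0n Nk_gt0.
    rewrite ler_pdivlMr // key; apply: le_trans h2.
    by rewrite ler_pM2l ?(mulr_gt0 theta_gt0 a0) // ler_nat leq_Nk.
  - have Nk0 : 0 < (Nk k)%:R :> R by rewrite ltr0n Nk_gt0.
    by rewrite -/theta mulrA [X in _ <= X]mulrAC mulfK // gt_eqF.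
  - by [].
  - rewrite [X in _ <= X](_ : _ = theta / (Rcompl K)%:R * (Nk k)%:R); last by rewrite /theta; ring.
    rewrite key'; apply: (le_trans h3); rewrite ler_pM2l ?(mulr_gt0 theta_gt0 a0) // ler_nat leq_Nk KE.
    by rewrite ltnNge kK.
rewrite lee_fin; apply: carpet_dim_tangent; rewrite ?divr_gt0 //.
apply: le_trans h1; rewrite le_eqVlt; apply/orP; left; apply/eqP; field.
by rewrite !gt_eqF.
Qed.

End Optimum.

(** * Every vector of Q is matched by a candidate *)

Section Candidates.
Variables (R : realType) (m n : nat) (A : {set 'I_m * 'I_n}).
Hypotheses (m_gt1 : (1 < m)%N) (mn : (m < n)%N) (hM : (0 < M0 A)%N).

Lemma alphaP (q : 'I_(M0 A) -> R) : Qset R A q -> exists u v : R,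
  [/\ alpha q = (carpet_dim m n u v)%:E, 0 < u /\ 0 < v,
      forall k, u <= q k / (Nk k)%:R, forall l, v <= q l &
      (exists k, u = q k / (Nk k)%:R) /\ (exists l, v = q l)].
Proof.
move=> [_ q0]; pose k0 := Ordinal hM.
have [k _ hk] := exists_min_val (P := xpredT) (fun k => q k / (Nk k)%:R) (i0 := k0) isT.
have [l _ hl] := exists_min_val (P := xpredT) q (i0 := k0) isT.
exists (q k / (Nk k)%:R), (q l); split; first by apply: alphaE => // ?; [exact: hk|exact: hl].
- by rewrite divr_gt0 ?q0 // ltr0n Nk_gt0.
- by move=> j; exact: hk.
- by move=> j; exact: hl.
- by split; [exists k|exists l].
Qed.

Lemma candidate_le (q : 'I_(M0 A) -> R) : Qset R A q ->
  (exists K : 'I_(M0 A), (alpha (small_q R K) <= alpha q)%E) \/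
  (exists2 K : 'I_(M0 A), (K.+1 < M0 A)%N & (alpha (big_q R K) <= alpha q)%E).
Proof.
move=> Qq; have [u [v [-> [u0 v0] hu hv [_ [l vl]]]]] := alphaP Qq.
have Pl : u * (Nk l)%:R <= v by rewrite vl -ler_pdivlMr ?hu // ltr0n Nk_gt0.
(* [K] is the largest class with u N_K <= v, found by minimising M0 - K; the class [l] where [q] is
   least shows that there is one. *)
have [K PK Kmax] := exists_min_val
  (P := fun k : 'I_(M0 A) => u * (Nk k)%:R <= v) (fun k => M0 A - k)%N Pl.
have hK := Qset_constraint K Qq hu hv.
set a : R := (Rcard K)%:R in hK *; set b : R := (Rcompl K)%:R in hK *.
(* The maximiser on the line v a + u b = 1 has ratio (1 - theta) b / (theta a). If this is at most
   N_K, the left end point [small_q K] wins. *)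
have [h|h] := lerP ((1 - log_ratio R m n) * b) (log_ratio R m n * a * (Nk K)%:R).
  left; exists K; apply: (alpha_small_q m_gt1 mn u0 v0 _ hK) => //.
  by rewrite mulr_ge0 // subr_ge0.
have b_gt0 : 0 < b.
  rewrite lt0r ler0n andbT; apply/negP => /eqP b0; move: h; rewrite b0 mulr0 ltNge.
  by rewrite !mulr_ge0 // ?invr_ge0 ln_ge0 // ler1n ?(ltnW m_gt1) // (leq_ltn_trans _ mn).
have K1 : (K.+1 < M0 A)%N by rewrite -Rcompl_gt0 -(ltr0n R).
pose K' := Ordinal K1.
have hK' : v < u * (Nk K')%:R.
  rewrite ltNge; apply/negP => /Kmax; rewrite leEnat /=; lia.
(* A ratio between N_K and N_K' leads to [big_q K]. Beyond N_K', the right end point [small_q K']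
   wins, with the coefficients of [K] by [Rsum_succ]. *)
have [h'|h'] := lerP (log_ratio R m n * a * (Nk K')%:R) ((1 - log_ratio R m n) * b); last first.
  by right; exists K => //; apply: (alpha_big_q m_gt1 mn (K' := K') erefl u0 v0 hK); exact: ltW.
left; exists K'; apply: (alpha_small_q m_gt1 mn u0 v0 _ hK).
  have /(congr1 (fun x => x%:R : R)) := @Rsum_succ _ _ A K K' erefl.
  by rewrite !natrD !natrM.
by rewrite mulr_le0 // subr_le0 // ltW.
Qed.

End Candidates.

(** * From weights to Q and back *)

Section Realisation.
Variables (R : realType) (m n : nat) (A : {set 'I_m * 'I_n}) (L : set (R * R)).
Hypotheses (m_gt1 : (1 < m)%N) (mn : (m < n)%N) (hL : is_carpet A L) (hM : (1 < M0 A)%N).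

Lemma two_columns : exists b1 b2, [/\ b1 \in A, b2 \in A & (b1.1 < b2.1)%N].
Proof.
have [x xA xE] := column_element (Ordinal (ltnW hM)).
have [y yA yE] := column_element (Ordinal hM).
have [xy|yx|e] := ltngtP x.1 y.1; [by exists x, y|by exists y, x|].
by move: xE; rewrite (val_inj e) yE => /Nk_inj.
Qed.

(** N_2 > N_1 >= 1, so a column of the second class holds two maps. *)
Lemma two_rows : exists c1 c2, [/\ c1 \in A, c2 \in A & (c1.2 < c2.2)%N].
Proof.
have [i iE] := Nk_column (Ordinal hM).
have : (1 < col_count A i)%N.
  rewrite iE; apply: (@leq_ltn_trans (Nk (Ordinal (ltnW hM)))); first exact: Nk_gt0.
  by rewrite ltn_Nk.
rewrite /col_count => /card_gt1P[x [y []]]; rewrite !inE => xA yA.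
by rewrite -(inj_eq val_inj) neq_ltn => /orP[xy|yx];
  [exists (i, x), (i, y)|exists (i, y), (i, x)].
Qed.

Lemma self_affine_measure_dim p : nondegenerate_weights A p -> exists u v : R,
  [/\ has_minkowski_dim L (self_affine_measure A p) (carpet_dim m n u v)%:E,
      0 < u /\ 0 < v, forall a, a \in A -> u <= p a,
      forall a, a \in A -> v <= column_weight A p a.1 &
      (exists2 a, a \in A & u = p a) /\
      (exists2 a, a \in A & v = column_weight A p a.1)].
Proof.
move=> hp; have [b1 [b2 [b1A b2A b12]]] := two_columns.
have [c1 [c2 [c1A c2A c12]]] := two_rows.
have [a0 a0A h0] := exists_min_val (P := fun a => a \in A) p b1A.
have [a1 a1A h1] := exists_min_val (P := fun a => a \in A)
  (fun a => column_weight A p a.1) b1A.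
(* Existence rules out the Dirac default of the choice operator. *)
have hnu : is_self_affine A p (self_affine_measure A p).
  exact: (xgetPex _ (self_affine_exists hp)).
exists (p a0), (column_weight A p a1.1); split=> //.
- exact: (self_affine_minkowski_dim m_gt1 mn hL hp hnu a0A a1A b1A b2A c1A c2A b12 c12 h0 h1).
- split; first exact: hp.1.
  apply: (@lt_le_trans _ _ ((col_count A a1.1)%:R * p a0)).
    by rewrite mulr_gt0 ?hp.1 // ltr0n col_count_gt0.
  exact: column_weight_ge.
- by split; [exists a0|exists a1].
Qed.

Lemma realise_Qset (q : 'I_(M0 A) -> R) p : Qset R A q ->
  (forall a, a \in A -> forall k : 'I_(M0 A), col_count A a.1 = Nk k ->
     p a = q k / (Nk k)%:R) ->
  nondegenerate_weights A p /\
  has_minkowski_dim L (self_affine_measure A p) (alpha q).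
Proof.
move=> Qq hpq; have [q1 q0] := Qq.
have N0 (k : 'I_(M0 A)) : (Nk k)%:R != 0 :> R by rewrite gt_eqF // ltr0n Nk_gt0.
have cw i (k : 'I_(M0 A)) : col_count A i = Nk k -> column_weight A p i = q k.
  move=> ik; rewrite (@column_weight_const _ _ _ _ _ _ (q k / (Nk k)%:R)).
    by rewrite ik mulrC divfK.
  by move=> a aA ai; apply: hpq => //; rewrite ai.
have hp : nondegenerate_weights A p.
  split=> [a aA|].
    have [k ak] := column_class (col_count_gt0 aA).
    by rewrite (hpq a aA k ak) divr_gt0 ?q0 // ltr0n Nk_gt0.
  rewrite sum_column_weight -[RHS]q1; apply: eq_bigr => k _.
  by rewrite -sum_class; apply: eq_bigr => i /eqP; exact: cw.
split=> //; have [u [v [hd _ hu hv [[a aA ua] [b bA vb]]]]] := self_affine_measure_dim hp.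
have [k ak] := column_class (col_count_gt0 aA).
have [l bl] := column_class (col_count_gt0 bA).
have uE : u = q k / (Nk k)%:R by rewrite ua; exact: hpq.
have vE : v = q l by rewrite vb; exact: cw.
rewrite (alphaE m_gt1 mn (k := k) (l := l) q0) -?uE -?vE //.
  by move=> j; have [c cA cj] := column_element j; rewrite uE -(hpq c cA j cj) -uE; exact: hu.
by move=> j; have [c cA cj] := column_element j; rewrite -(cw _ _ cj); exact: hv.
Qed.

(** Averages over columns of equal size keep the lower bound [v]. As a column of N_k maps weighs at
    least N_k u, they also keep the bound [u] for q_k / N_k; then [alpha_le] applies. *)
Lemma average_Qset p : nondegenerate_weights A p ->
  exists2 q : 'I_(M0 A) -> R, Qset R A q &
  forall d, has_minkowski_dim L (self_affine_measure A p) d -> (alpha q <= d)%E.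
Proof.
move=> hp; have [u [v [hd [u0 v0] hu hv _]]] := self_affine_measure_dim hp.
have Rk0 (k : 'I_(M0 A)) : 0 < (Rk k)%:R :> R by rewrite ltr0n Rk_gt0.
pose q k := (\sum_(i | col_count A i == @Nk m n A k) column_weight A p i) / (Rk k)%:R.
have class_ge (k : 'I_(M0 A)) (c : R) :
    (forall i, col_count A i = Nk k -> c <= column_weight A p i) -> c <= q k.
  move=> hc; rewrite ler_pdivlMr // mulrC -sum_class.
  by apply: ler_sum => i /eqP; exact: hc.
have vq l : v <= q l.
  apply: class_ge => i il.
  have : (0 < col_count A i)%N by rewrite il Nk_gt0.
  rewrite /col_count => /card_gt0P[j]; rewrite inE => ijA.
  exact: (hv (i, j)).
exists q.
  split=> [|k]; last exact: lt_le_trans v0 (vq k).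
  rewrite -[RHS]hp.2 sum_column_weight; apply: eq_bigr => k _.
  by rewrite /q mulrC divfK // gt_eqF.
move=> d [hd1 _]; have -> : d = (carpet_dim m n u v)%:E by rewrite -hd1 hd.1.
apply: alpha_le => // k; rewrite ler_pdivlMr ?ltr0n ?Nk_gt0 // mulrC.
by apply: class_ge => i <-; exact: column_weight_ge.
Qed.

End Realisation.

(** The candidates are finite in number, so one of them is best, and [candidate_le] makes it best in
    all of Q. Thus the minimum is attained although Q is defined by strict inequalities. *)
Lemma best_candidate (R : realType) (m n : nat) (A : {set 'I_m * 'I_n}) :
  (1 < m)%N -> (m < n)%N -> (0 < M0 A)%N ->
  exists2 q : 'I_(M0 A) -> R, Qset R A q /\
    ((exists K, q = small_q R K) \/
     (exists2 K : 'I_(M0 A), (K.+1 < M0 A)%N & q = big_q R K)) &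
  forall q', Qset R A q' -> (alpha q <= alpha q')%E.
Proof.
move=> m_gt1 mn hM.
pose c (i : 'I_(M0 A) * bool) := if i.2 then small_q R i.1 else big_q R i.1.
have [[K b] /= Kb Kmin] := exists_min_val
  (P := fun i : 'I_(M0 A) * bool => i.2 || (i.1.+1 < M0 A)%N)
  (fun i => alpha (c i)) (i0 := (Ordinal hM, true)) isT.
exists (c (K, b)).
  case: b Kb {Kmin} => /= Kb.
    by split; [exact: small_q_Qset|left; exists K].
  by split; [exact: big_q_Qset|right; exists K].
move=> q' /(candidate_le m_gt1 mn hM)[[K' h]|[K' K'1 h]]; apply: le_trans h.
  exact: (Kmin (K', true)).
exact: (Kmin (K', false)).
Qed.

Lemma class_weights (R : realType) (m n : nat) (A : {set 'I_m * 'I_n})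
    (q : 'I_(M0 A) -> R) :
  exists p : 'I_m * 'I_n -> R, forall a, a \in A -> forall k : 'I_(M0 A),
    col_count A a.1 = Nk k -> p a = q k / (Nk k)%:R.
Proof.
exists (fun a => if [pick k : 'I_(M0 A) | col_count A a.1 == Nk k] is Some k
  then q k / (Nk k)%:R else 0) => a aA k ak.
case: pickP => [l /eqP al|/(_ k)]; last by rewrite ak eqxx.
by have -> : l = k by apply: Nk_inj; rewrite -al.
Qed.

Theorem theorem2p5 (R : realType) (m n : nat) (A : {set 'I_m * 'I_n})
    (L : set (R * R)) (hm : (2 <= m)%N) (hmn : (m < n)%N)
    (hL : is_carpet A L) (hM : (2 <= M0 A)%N) :
  (forall p : 'I_m * 'I_n -> R, nondegenerate_weights A p ->
     exists d, has_minkowski_dim L (self_affine_measure A p) d) /\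
  exists v : \bar R,
    [/\ is_minimum
          [set d | exists2 p : 'I_m * 'I_n -> R, nondegenerate_weights A p &
                     has_minkowski_dim L (self_affine_measure A p) d] v,
        is_minimum [set alpha q | q in Qset R A] v,
        (exists K : 'I_(M0 A),
           Qset R A (small_q R K) /\
           alpha (small_q R K) = v) \/
        (exists K : 'I_(M0 A),
           [/\ (K.+1 < M0 A)%N, Qset R A (big_q R K) &
               alpha (big_q R K) = v]) &
        forall (q : 'I_(M0 A) -> R) (p : 'I_m * 'I_n -> R),
          Qset R A q -> alpha q = v ->
          (forall a, a \in A -> forall k : 'I_(M0 A),
             col_count A a.1 = Nk k -> p a = q k / (Nk k)%:R) ->
          nondegenerate_weights A p /\
          has_minkowski_dim L (self_affine_measure A p) v].
Proof.
split=> [p /(self_affine_measure_dim hm hmn hL hM)[u [v [h _ _ _ _]]]|].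
  by exists (carpet_dim m n u v)%:E.
have [q [Qq qE] qmin] := best_candidate R hm hmn (ltnW hM).
(* The weights that are constant on each class turn the optimal value of [alpha] into an attained
   dimension; averaging shows that no dimension is smaller. *)
have [p0 hp0] := class_weights q.
have [hp0w hp0d] := realise_Qset hm hmn hL hM Qq hp0.
exists (alpha q); split.
- split; first by exists p0.
  move=> d [p hp hd]; have [q' Qq' hq'] := average_Qset hm hmn hL hM hp.
  exact: le_trans (qmin _ Qq') (hq' _ hd).
- by split; [exists q|move=> _ [q' Qq' <-]; exact: qmin].
- case: qE => [[K qK]|[K K1 qK]]; [left|right]; exists K; by rewrite -?qK.
- move=> q' p Qq' <- hp; exact: realise_Qset hp.
Qed.
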